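(* Let $n\ge 2$ and let $G(x,t)=e^{v(x,t)}x$, $x\in\mathcal S$, $t\ge 0$, be a graphical translating soliton to mean curvature flow in $\mathbb H^{n+1}$ whose initial condition $G(\mathcal S\times\{0\})$ is a horizontal horosphere. Set $v_0:=v(\cdot,0)$ and assume that $u_0$ is a locally Lipschitz function on $\mathcal S$ such that $$\lim_{x\to\partial\mathcal S}|u_0(x)-v_0(x)|=0.$$ Then, for any graphical solution $u=u(x,t)$ to mean curvature flow in $\mathbb H^{n+1}$ defined for all $t\ge 0$ and with initial condition $u(\cdot,0)=u_0$, one has that $u(\cdot,t)-v(\cdot,t)$ converges uniformly to $0$ on $\mathcal S$ as $t\to+\infty$.
   Context: $\mathbb H^{n+1}$, $n+1\ge 3$, is the upper half-space $\mathbb R^{n+1}_+=\{(x_1,\dots,x_{n+1}) : x_{n+1}>0\}$ with the metric $\langle\,,\rangle=ds^2=d\bar s^2/x_{n+1}^2$, where $d\bar s^2$ is the Euclidean metric. For an oriented hypersurface with unit normal $N$, the shape operator is $Av=-\overline\nabla_vN$ ($\overline\nabla$ the Levi-Civita connection of $\mathbb H^{n+1}$), and the mean curvature is the normalized one, $H=(k_1+\cdots+k_n)/n$, where $k_1,\dots,k_n$ are the eigenvalues of $A$. The mean curvature vector is $\mathbf H=HN$, and mean curvature flow (MCF) is the evolution with velocity $\mathbf H$. $\mathcal S\subset\mathbb R^{n+1}_+$ is the open upper hemisphere $\{x\in\mathbb R^{n+1} : \|x\|=1,\ x_{n+1}>0\}$ of the Euclidean unit sphere centered at the origin (a totally geodesic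 hyperplane of $\mathbb H^{n+1}$). The notation $x\to\partial\mathcal S$ means that $x$ escapes every compact subset of $\mathcal S$. Graphical solution: for $0<T\le\infty$, a function $u\in C^\infty(\mathcal S\times(0,T))\cap C^0(\mathcal S\times[0,T))$ is a graphical solution to MCF in $\mathbb H^{n+1}$ if, writing $u_t=u(\cdot,t)$ and $F(x,t)=F_t(x)=e^{u_t(x)}x$, it satisfies on $\mathcal S\times(0,T)$ $$\frac{\partial u}{\partial t}(x,t)=x_{n+1}\sqrt{1+\|\nabla u_t(x)\|^2}\;H(x,t),$$ where $x_{n+1}$ is the last coordinate of $x\in\mathcal S$, $\nabla u_t(x)$ is the gradient of $u_t$ at $x$ in the canonical metric of the unit sphere $\mathbb S^n$, $\|\cdot\|$ is the Euclidean norm, and $H(x,t)$ is the mean curvature with respect to the hyperbolic metric of the radial graph $F_t(\mathcal S)$ at the point $F_t(x)$, for the upward orientation (the unit normal $N$ having positive inner product with the position vector). The map $F$ is then called a graphical MCF. Hyperbolic translations along the $x_{n+1}$-axis are the isometries $\Gamma_t(p)=e^tp$, $t\in\mathbb R$, with Killing field $\xi(p)=p$. A translator is an oriented hypersurface $\Sigma$ with $H(p)=\langle p,N(p)\rangle$ for all $p\in\Sigma$; it moves under MCF by $\Gamma_t$ (up to tangential motion). A graphical translating soliton is a graphical MCF $G(x,t)=e^{v(x,t)}x$ with $G(\mathcal S\times\{t\})=\Gamma_t(G(\mathcal S\times\{0\}))$, i.e. $v(x,t)=v(x,0)+t$, where $G(\mathcal S\times\{0\})$ is a translator. A horizontal horosphere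 is a set $\{x_{n+1}=h\}\subset\mathbb H^{n+1}$ with $h>0$ (it is a translator, and it is the radial graph of $x\mapsto \log h-\log x_{n+1}$ over $\mathcal S$). *)

(* Defs.v *)
From HB Require Import structures.
From mathcomp Require Export all_boot all_order all_algebra.
From mathcomp Require Export all_classical all_reals all_analysis.
Export Order.TTheory GRing.Theory Num.Theory.
Export numFieldNormedType.Exports.

Set Implicit Arguments.
Unset Strict Implicit.
Unset Printing Implicit Defensive.

Local Open Scope classical_set_scope.
Local Open Scope ring_scope.

(* The library norm on ['rV[R]_n.+1] is the sup norm (equivalent to, but
   different from, the Euclidean one), hence [enorm]. *)
Definition edot (R : realType) (n : nat) (v w : 'rV[R]_n) : R :=
  \sum_i v 0 i * w 0 i.

Definition enorm (R : realType) (n : nat) (v : 'rV[R]_n) : R :=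
  Num.sqrt (edot v v).

(* The coordinate x_{n+1}. *)
Definition height (R : realType) (n : nat) (x : 'rV[R]_n.+1) : R := x 0 ord_max.

Definition halfspace (R : realType) (n : nat) : set 'rV[R]_n.+1 :=
  [set p | 0 < height p].

Definition hemisphere (R : realType) (n : nat) : set 'rV[R]_n.+1 :=
  [set x | enorm x = 1 /\ 0 < height x].

(* The filter "x -> boundary of the hemisphere": x leaves every compact subset. *)
Definition hemisphere_boundary (R : realType) (n : nat) :
    set_system 'rV[R]_n.+1 :=
  [set P | exists K : set 'rV[R]_n.+1,
     [/\ compact K, K `<=` @hemisphere R n & @hemisphere R n `\` K `<=` P]].

#[global] Instance hemisphere_boundary_filter (R : realType) (n : nat) :
  Filter (@hemisphere_boundary R n).
Proof.
split.
- by exists set0; split => //; exact: compact0.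
- move=> P Q [K [cK KS KP]] [L [cL LS LQ]]; exists (K `|` L); split.
  + exact: compactU.
  + by move=> x [/KS|/LS].
  + move=> x [Sx KLx]; split.
      by apply: KP; split => // Kx; apply: KLx; left.
    by apply: LQ; split => // Lx; apply: KLx; right.
- move=> P Q PQ [K [cK KS KP]]; exists K; split => //.
  exact: subset_trans PQ.
Qed.

(* A map on the hemisphere is given by a map on the ambient space of which only
   the values on the hemisphere matter: it is always precomposed with the
   smooth retraction [sproj] of the half-space onto the hemisphere. *)
Definition sproj (R : realType) (n : nat) (p : 'rV[R]_n) : 'rV[R]_n :=
  (enorm p)^-1 *: p.

(* The differential at x of a map on the hemisphere, applied to w tangent at x. *)
Definition sdiff (R : realType) (n : nat) (W : normedModType R)
    (f : 'rV[R]_n.+1 -> W) (x w : 'rV[R]_n.+1) : W :=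
  'D_w (f \o @sproj R n.+1) x.

Definition stangent (R : realType) (n : nat) (x : 'rV[R]_n.+1) :
    set 'rV[R]_n.+1 :=
  [set w | edot w x = 0].

(* Since [f \o sproj] is constant on rays, its Euclidean gradient at a point of
   the sphere is tangent to the sphere: it is the gradient of f for the
   canonical metric of the sphere. *)
Definition sgrad (R : realType) (n : nat) (f : 'rV[R]_n.+1 -> R)
    (x : 'rV[R]_n.+1) : 'rV[R]_n.+1 :=
  \row_i sdiff f x (delta_mx 0 i).

(* Functions of class C^k on an open subset D of a finite-dimensional space. *)
Fixpoint Ck_on (R : realType) (V : normedModType R) (k : nat) (D : set V)
    (f : V -> R) : Prop :=
  (forall x, D x -> {for x, continuous f}) /\
  match k with
  | 0 => True
  | k'.+1 => (forall x v, D x -> derivable f x v) /\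
             (forall v, Ck_on k' D (fun x => 'D_v f x))
  end.

Definition smooth_on (R : realType) (V : normedModType R) (D : set V)
    (f : V -> R) : Prop :=
  forall k, Ck_on k D f.

Definition locally_lipschitz_on (R : realType) (V : normedModType R)
    (D : set V) (f : V -> R) : Prop :=
  forall x, D x -> exists2 U, nbhs x U & [lipschitz f y | y in U `&` D].

Definition hmetric (R : realType) (n : nat) (p : 'rV[R]_n.+1) : 'M[R]_n.+1 :=
  (height p ^- 2)%:M.

Definition hinner (R : realType) (n : nat) (p v w : 'rV[R]_n.+1) : R :=
  (v *m hmetric p *m w^T) 0 0.

(* The Christoffel symbol Gamma^k_{ij} of the Levi-Civita connection of the
   Riemannian metric g. *)
Definition christoffel (R : realType) (n : nat)
    (g : 'rV[R]_n.+1 -> 'M[R]_n.+1) (p : 'rV[R]_n.+1) (k i j : 'I_n.+1) : R :=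
  2^-1 * \sum_l invmx (g p) k l *
    ('D_(delta_mx 0 i) (fun q => g q j l) p
     + 'D_(delta_mx 0 j) (fun q => g q i l) p
     - 'D_(delta_mx 0 l) (fun q => g q i j) p).

(* The Levi-Civita derivative, in the direction dF_x(w), of a vector field N
   along the map F from the hemisphere to hyperbolic space. *)
Definition hconn (R : realType) (n : nat) (F N : 'rV[R]_n.+1 -> 'rV[R]_n.+1)
    (x w : 'rV[R]_n.+1) : 'rV[R]_n.+1 :=
  sdiff N x w +
  \row_k \sum_i \sum_j
    christoffel (@hmetric R n) (F x) k i j * sdiff F x w 0 i * N x 0 j.

Definition upward_unit_normal (R : realType) (n : nat)
    (F N : 'rV[R]_n.+1 -> 'rV[R]_n.+1) : Prop :=
  forall x, hemisphere x ->
    [/\ hinner (F x) (N x) (N x) = 1,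
        forall w, stangent x w -> hinner (F x) (N x) (sdiff F x w) = 0 &
        0 < hinner (F x) (N x) (F x)].

(* The numbers k_i are the eigenvalues, with multiplicity, of the shape operator
   A v = - nabla_v N of the hypersurface F at F x: the tangent space at F x has
   a basis of eigenvectors dF_x(E_i), where the rows E_i of E form a basis of
   the tangent space of the hemisphere at x. *)
Definition principal_curvatures (R : realType) (n : nat)
    (F N : 'rV[R]_n.+1 -> 'rV[R]_n.+1) (x : 'rV[R]_n.+1) (k : 'I_n -> R) : Prop :=
  exists E : 'M[R]_(n, n.+1),
    [/\ row_free E,
        forall i, stangent x (row i E) &
        forall i, - hconn F N x (row i E) = k i *: sdiff F x (row i E)].

Definition mean_curvature (R : realType) (n : nat)
    (F N : 'rV[R]_n.+1 -> 'rV[R]_n.+1) (x : 'rV[R]_n.+1) (H : R) : Prop :=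
  exists2 k : 'I_n -> R, principal_curvatures F N x k & H = (\sum_i k i) / n%:R.

Definition radial_graph (R : realType) (n : nat) (w : 'rV[R]_n.+1 -> R)
    (x : 'rV[R]_n.+1) : 'rV[R]_n.+1 :=
  expR (w x) *: x.

(* [u x t] stands for u(x,t). *)
Definition graphical_solution (R : realType) (n : nat) (T : \bar R)
    (u : 'rV[R]_n.+1 -> R -> R) : Prop :=
  [/\ (0 < T)%E,
      smooth_on
        [set z : 'rV[R]_n.+1 * R | [/\ halfspace z.1, 0 < z.2 & (z.2%:E < T)%E]]
        (fun z => u (sproj z.1) z.2),
      {within [set z : 'rV[R]_n.+1 * R |
                [/\ hemisphere z.1, 0 <= z.2 & (z.2%:E < T)%E]],
        continuous (fun z : 'rV[R]_n.+1 * R => u z.1 z.2)} &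
      forall t : R, 0 < t -> (t%:E < T)%E ->
        exists2 N, upward_unit_normal (radial_graph (u^~ t)) N &
        forall x, hemisphere x ->
          exists2 H, mean_curvature (radial_graph (u^~ t)) N x H &
          derive1 (u x) t =
            height x * Num.sqrt (1 + enorm (sgrad (u^~ t) x) ^+ 2) * H].

Definition translator (R : realType) (n : nat)
    (F : 'rV[R]_n.+1 -> 'rV[R]_n.+1) : Prop :=
  exists2 N, upward_unit_normal F N &
    forall x, hemisphere x -> mean_curvature F N x (hinner (F x) (F x) (N x)).

Definition hyp_translation (R : realType) (n : nat) (t : R)
    (p : 'rV[R]_n.+1) : 'rV[R]_n.+1 :=
  expR t *: p.

Definition graphical_translating_soliton (R : realType) (n : nat)
    (v : 'rV[R]_n.+1 -> R -> R) : Prop :=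
  [/\ graphical_solution +oo%E v,
      forall t : R, 0 <= t ->
        radial_graph (v^~ t) @` @hemisphere R n =
        hyp_translation t @` (radial_graph (v^~ 0) @` @hemisphere R n) &
      translator (radial_graph (v^~ 0))].

Definition horizontal_horosphere (R : realType) (n : nat)
    (A : set 'rV[R]_n.+1) : Prop :=
  exists2 h : R, 0 < h & A = [set p | height p = h].

(* Main.v *)
Require Import Defs.
From mathcomp Require Import ring lra.
Local Open Scope classical_set_scope.
Local Open Scope ring_scope.
(** Why the theorem holds.  Let F = e^u x be the point of the moving graph over x,
let y be its height and let q = e^(-t) y.  On the soliton the height is h e^t,
so that q / h = e^(u - v), and the claim is that q tends to h uniformly.

Along mean curvature flow, let Phi(p, t) be a function on the half-space.  At a
spatial maximum of Phi on the graph the gradient of Phi is normal to the graph,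
and the second order condition bounds the mean curvature term; a maximum in
space and past time therefore satisfies
  n (Phi_t + y Phi_y) - y^2 tr (D^2 Phi) >= 0,
where the trace is taken over the Euclidean hyperplane tangent to the graph
([flow_no_interior_max]).  This requires the mean curvature of a radial graph in
terms of the gradient and the Hessian of u: the unit normal is determined by its
defining conditions, hence is differentiable ([unit_normalE]); differentiating it
turns each principal direction into an eigenvector of the Hessian of u relative
to the metric I + a a^T, where a is the gradient ([principal_direction]); and
the sum of the eigenvalues is a trace ([graph_mean_curvature]).

Three functions on the half-space behave well whatever the tangent hyperplane is.
- q gives equality: horizontal horospheres move by translations.
- G = exp (-2 al t - ka |z|^2), with z the horizontal part of e^(-t) p, is a
  supersolution as long as q stays between two positive constants, for suitable
  positive al and ka.  A hyperplane keeps at least n - 1 of the n horizontal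
  directions, and n >= 2 is what makes the decay rate al positive.
- e^(3t) (|p|^2 + 1/y) is a strict supersolution that tends to infinity at the
  ideal boundary.
With a small multiple of the third function subtracted, every superlevel set
over a bounded time interval is compact, so that a maximum exists although
nothing is known a priori on u near the boundary of the hemisphere; the multiple
then tends to 0 ([flow_comparison]).  Applied to q and to - q, this keeps q
between the bounds that it satisfies at time 0 ([horosphere_barrier]).  At time
0 the difference between q and h is small outside a compact set, hence at most a
small constant plus B G for B large; the comparison applied to q - B G and to
- q - B G preserves this, and G <= e^(-2 al t) decays ([gheight_converges]). *)

Set Implicit Arguments.
Unset Strict Implicit.
Unset Printing Implicit Defensive.

(** * One-variable calculus *)

Section calculus.
Variable R : realType.
Implicit Types (V : normedModType R) (s h : R).

Lemma is_derive_line V (W : normedModType R) (g : V -> W) (x w : V) s (d : W) :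
  is_derive (s *: w + x) w g d ->
  is_derive s 1 (fun r : R => g (r *: w + x)) d.
Proof.
have E : (fun h => h^-1 *: (((fun r : R => g (r *: w + x)) \o shift s) (h *: 1)
      - g (s *: w + x))) =
  (fun h => h^-1 *: ((g \o shift (s *: w + x)) (h *: w) - g (s *: w + x))).
  by apply/funext => h /=; rewrite [h *: 1]mulr1 scalerDl addrA.
move=> [gd gE]; apply: DeriveDef.
  by rewrite /derivable E.
by rewrite -gE /derive E.
Qed.

Lemma is_derive_line0 V (W : normedModType R) (g : V -> W) (x w : V) (d : W) :
  is_derive x w g d ->
  is_derive (0 : R) 1 (fun r : R => g (r *: w + x)) d.
Proof. move=> gd; have gd0 : is_derive (0 *: w + x) w g d by rewrite scale0r add0r.
exact: is_derive_line gd0. Qed.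

Lemma derive_line0 V (W : normedModType R) (g : V -> W) (x w : V) :
  'D_w g x = 'D_1 (fun r : R => g (r *: w + x)) (0 : R).
Proof.
rewrite /derive; set F := (X in lim (X @ _) = _).
set G := (X in _ = lim (X @ _)).
suff -> : F = G by [].
by apply/funext => h; rewrite /F /G /= [h *: 1]mulr1 addr0 scale0r add0r.
Qed.

Lemma is_derive_line0P V (W : normedModType R) (g : V -> W) (x w : V) (d : W) :
  is_derive (0 : R) 1 (fun r : R => g (r *: w + x)) d -> is_derive x w g d.
Proof.
by move=> [gd gE]; apply: DeriveDef; [exact/derivable1P|rewrite derive_line0].
Qed.

Lemma is_derive_gt0_near (f : R -> R) (c d : R) :
  is_derive c 1 f d -> 0 < d ->
  \forall h \near (0 : R),
    (0 < h -> f c < f (h + c)) /\ (h < 0 -> f (h + c) < f c).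
Proof.
move=> [fd fE] d0; rewrite /derivable in fd.
have /cvgrPdist_lt /(_ d d0) : (fun h => h^-1 *: ((f \o shift c) (h *: 1) - f c))
    @ 0^' --> d by rewrite -fE.
rewrite near_withinE; apply: filterS => h H; split=> h0.
  move: H; rewrite gt_eqF // => /(_ isT); rewrite /= [h *: 1]mulr1.
  rewrite ltr_norml => /andP[_]; rewrite ltrBlDr ltrDl.
  by rewrite [_ *: _]mulrC pmulr_lgt0 ?invr_gt0// subr_gt0.
move: H; rewrite lt_eqF // => /(_ isT); rewrite /= [h *: 1]mulr1.
rewrite ltr_norml => /andP[_]; rewrite ltrBlDr ltrDl.
by rewrite [_ *: _]mulrC nmulr_lgt0 ?invr_lt0// subr_lt0.
Qed.

(** Only times before c are compared, because in the maximum principle the maximum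
may be attained at the end of the time interval. *)
Lemma is_derive_ge0_left_max (f : R -> R) (a c d : R) : a < c ->
  is_derive c 1 f d -> (forall t, a <= t <= c -> f t <= f c) -> 0 <= d.
Proof.
move=> ac fd fmax; rewrite leNgt; apply/negP => d0.
have /is_derive_gt0_near : is_derive c 1 (- f) (- d) by exact: is_deriveN.
rewrite oppr_gt0 => /(_ d0) /nbhs_ballP[e /= e0 /(_ _ _)/= He].
pose h := - Num.min (e / 2) (c - a).
have h0 : h < 0 by rewrite oppr_lt0 lt_min subr_gt0 ac divr_gt0.
have [|_ /(_ h0)] := He h.
  rewrite /ball /= sub0r opprK ger0_norm; last by rewrite ltW // -oppr_lt0.
  by rewrite gt_min ltr_pdivrMr // mulr_natr mulr2n ltrDl e0.
rewrite ltrN2 ltNge fmax //; apply/andP; split; last by rewrite gerDr ltW.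
by rewrite -lerBlDr /h lerNr opprB ge_min lexx orbT.
Qed.

(** The derivative of g is asked for near 0, but only its value and its slope at 0
are recorded: jets then compose by algebra alone, without any formula for the
derivative away from 0. *)
Definition jet2 (g : R -> R) (a0 a1 a2 : R) := exists g' : R -> R,
  [/\ \forall s \near (0 : R), is_derive (s : R) (1 : R) g (g' s),
      g 0 = a0, g' 0 = a1 & is_derive (0 : R) 1 g' a2].

Lemma jet2_eq g a0 a1 a2 b0 b1 b2 : jet2 g a0 a1 a2 ->
  a0 = b0 -> a1 = b1 -> a2 = b2 -> jet2 g b0 b1 b2.
Proof. by move=> ? <- <- <-. Qed.

Lemma near_derivable_continuous (g g' : R -> R) :
  (\forall s \near (0 : R), is_derive (s : R) (1 : R) g (g' s)) -> {for 0, continuous g}.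
Proof.
move=> /nbhs_singleton[gd _].
exact/differentiable_continuous/derivable1_diffP.
Qed.

Lemma jet2_cst (c : R) : jet2 (fun=> c) c 0 0.
Proof.
exists (fun=> 0); split => //.
  by near=> s; exact: is_derive_cst.
exact: is_derive_cst.
Unshelve. all: by end_near. Qed.

Lemma jet2_affine (a b : R) : jet2 (fun s => s * b + a) a b 0.
Proof.
exists (fun=> b); split => //; last exact: is_derive_cst.
  near=> s.
  have H1 : is_derive s 1 (fun r : R => r * b) b.
    apply: (is_derive_eq (is_deriveM (is_derive_id s 1) (is_derive_cst b s 1))).
    by rewrite /= scaler0 add0r [_ *: _]mulr1.
  by apply: (is_derive_eq (is_deriveD H1 (is_derive_cst a s 1))); rewrite addr0.
by rewrite mul0r add0r.
Unshelve. all: by end_near. Qed.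

Lemma jet2D f g a0 a1 a2 b0 b1 b2 : jet2 f a0 a1 a2 -> jet2 g b0 b1 b2 ->
  jet2 (fun s => f s + g s) (a0 + b0) (a1 + b1) (a2 + b2).
Proof.
move=> [f' [f1 f0 f'0 f2]] [g' [g1 g0 g'0 g2]].
exists (fun s => f' s + g' s); split; rewrite ?f0 ?f'0 ?g0 ?g'0 //.
  by near=> s; apply: is_deriveD; near: s.
exact: is_deriveD.
Unshelve. all: by end_near. Qed.

Lemma jet2M f g a0 a1 a2 b0 b1 b2 : jet2 f a0 a1 a2 -> jet2 g b0 b1 b2 ->
  jet2 (fun s => f s * g s) (a0 * b0) (a1 * b0 + a0 * b1)
    (a2 * b0 + 2 * (a1 * b1) + a0 * b2).
Proof.
move=> [f' [f1 f0 f'0 f2]] [g' [g1 g0 g'0 g2]].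
have d1 : is_derive (0 : R) 1 f a1 by rewrite -f'0; exact: nbhs_singleton f1.
have d2 : is_derive (0 : R) 1 g b1 by rewrite -g'0; exact: nbhs_singleton g1.
exists (fun s => f' s * g s + f s * g' s); split; rewrite ?f0 ?f'0 ?g0 ?g'0 //.
  near=> s.
  have := @is_deriveM R R f g s 1 (f' s) (g' s) _ _.
  move=> /(_ _ _)/is_derive_eq; apply.
  - by near: s.
  - by near: s.
  - by rewrite addrC; congr (_ + _); rewrite [_ *: _]mulrC.
have := @is_deriveD _ _ _ (f' * g) (f * g') 0 1 _ _ (is_deriveM f2 d2) (is_deriveM d1 g2).
move/is_derive_eq; apply.
by rewrite f0 g0 f'0 g'0 /GRing.scale /=; ring.
Unshelve. all: by end_near. Qed.

Lemma is_derive_exp (g : R -> R) s (d : R) : is_derive s 1 g d ->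
  is_derive s 1 (fun r => expR (g r)) (d * expR (g s)).
Proof.
by move=> gd; rewrite mulrC; exact: (@is_derive1_comp R expR g s).
Qed.

Lemma jet2_exp f a0 a1 a2 : jet2 f a0 a1 a2 ->
  jet2 (fun s => expR (f s)) (expR a0) (a1 * expR a0) ((a2 + a1 ^+ 2) * expR a0).
Proof.
move=> [f' [f1 f0 f'0 f2]].
have d1 : is_derive (0 : R) 1 f a1 by rewrite -f'0; exact: nbhs_singleton f1.
exists (fun s => f' s * expR (f s)); split; rewrite ?f0 ?f'0 //.
  by near=> s; apply: is_derive_exp; near: s.
have /is_derive_eq := is_deriveM f2 (is_derive_exp d1); apply.
by rewrite f0 f'0 /GRing.scale /=; ring.
Unshelve. all: by end_near. Qed.

Lemma jet2V f (a0 a1 a2 : R) : a0 != 0 -> jet2 f a0 a1 a2 ->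
  jet2 (fun s => (f s)^-1) a0^-1 (- a1 * a0^-1 ^+ 2)
    (- a2 * a0^-1 ^+ 2 + 2 * a1 ^+ 2 * a0^-1 ^+ 3).
Proof.
move=> a0n [f' [f1 f0 f'0 f2]].
have d1 : is_derive (0 : R) 1 f a1 by rewrite -f'0; exact: nbhs_singleton f1.
have fn : \forall s \near (0 : R), f s != 0.
  have := near_derivable_continuous f1; rewrite /prop_for /continuous_at f0.
  by move/cvgr_neq0; apply.
have dV : is_derive (0 : R) 1 (fun y => (f y)^-1) (- (a0 ^- 2) * a1).
  have := @is_deriveV R f 0 a1 1; rewrite f0 => /(_ a0n d1); exact.
exists (fun s => - f' s * ((f s)^-1 * (f s)^-1)); split; rewrite ?f0 ?f'0 //.
  near=> s.
  have /is_derive_eq : is_derive s 1 (fun y => (f y)^-1) (- (f s) ^- 2 *: f' s).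
    by apply: is_deriveV; near: s.
  by apply; rewrite -expr2 -exprVn /GRing.scale /=; ring.
have /is_derive_eq := is_deriveM (is_deriveN f2) (is_deriveM dV dV); apply.
rewrite /= /GRing.scale /= f0 -![(_ * _ : _ -> _) _]/(_ * _).
have -> : (- f') 0 = - a1 by rewrite -f'0.
by rewrite f0 -exprVn; ring.
Unshelve. all: by end_near. Qed.

(** If the second derivative were positive, the first one would be positive just
after 0, and g would increase there by the mean value theorem. *)
Lemma jet2_max g a0 a1 a2 : jet2 g a0 a1 a2 ->
  (\forall s \near (0 : R), g s <= g 0) -> a1 = 0 /\ a2 <= 0.
Proof.
move=> [g' [g1 g0 g'0 g2]] gmax.
have [e /= e0 H] : exists2 e : R, 0 < e & forall s, `|s| < e ->
    is_derive (s : R) (1 : R) g (g' s) /\ g s <= g 0.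
  have /nbhs_ballP[e /= e0 H] : \forall s \near (0 : R),
      is_derive (s : R) (1 : R) g (g' s) /\ g s <= g 0.
    by near=> s; split; near: s.
  by exists e => // s se; apply: H; rewrite /ball /= sub0r normrN.
have a10 : a1 = 0.
  have : is_derive (0 : R) 1 g 0.
    apply: (@derive1_at_max R g (- e) e 0).
    - by rewrite ge0_cp // ltW.
    - move=> t; rewrite in_itv /= -ltr_norml => /H[[]]//.
    - by rewrite in_itv /= oppr_lt0 e0.
    - by move=> t; rewrite in_itv /= -ltr_norml => /H[].
  move=> [_ <-]; rewrite -g'0.
  by have [|[_ ->]] := H 0; rewrite ?normr0.
split=> //; rewrite leNgt; apply/negP => a20.
have /nbhs_ballP[r /= r0 Hr] := is_derive_gt0_near g2 a20.
pose s := Num.min (e / 2) (r / 2).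
have s0 : 0 < s by rewrite lt_min !divr_gt0.
have se : s < e by rewrite gt_min ltr_pdivrMr // mulr_natr mulr2n ltrDl e0.
have sr : s < r.
  by rewrite gt_min orbC ltr_pdivrMr // mulr_natr mulr2n ltrDl r0.
have dg c : 0 <= c -> c <= s -> is_derive c 1 g (g' c).
  by move=> c0 cs; have [] := H c; rewrite // ger0_norm // (le_lt_trans cs).
have [|||c] := @MVT R g g' 0 s.
- by [].
- by move=> c; rewrite in_itv /= => /andP[c0 cs]; apply: dg; exact: ltW.
- apply: derivable_within_continuous => c; rewrite in_itv /= => /andP[c0 cs].
  by have [] := dg c c0 cs.
rewrite in_itv /= => /andP[c0 cs] E.
have : 0 < g' c * (s - 0).
  rewrite subr0 mulr_gt0 //.
  have [|/(_ c0)] := Hr c; last by rewrite addr0 g'0 a10.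
  by rewrite /ball /= sub0r normrN gtr0_norm // (lt_trans cs).
rewrite -E subr_gt0 ltNge.
by have [|_ ->] := H s; rewrite // gtr0_norm.
Unshelve. all: by end_near. Qed.

(** The increment in the direction v + w is split at the point x + h v.  The mean
value theorem turns the part along w into a directional derivative at a point
close to x, which is where its continuity is used. *)
Lemma is_derive_dirD V (g : V -> R) (x v w : V) :
  derivable g x v -> (\forall y \near x, derivable g y w) ->
  {for x, continuous (fun y => 'D_w g y)} ->
  is_derive x (v + w) g ('D_v g x + 'D_w g x).
Proof.
move=> gv gw cw.
suff cvgL : (fun h => h^-1 *: ((g \o shift x) (h *: (v + w)) - g x)) @ 0^'
    --> 'D_v g x + 'D_w g x.
  apply: DeriveDef; first by rewrite /derivable; apply/cvg_ex; eexists; exact: cvgL.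
  exact/cvg_lim.
have -> : (fun h => h^-1 *: ((g \o shift x) (h *: (v + w)) - g x)) =
  (fun h => h^-1 *: ((g \o shift x) (h *: v) - g x)) \+
  (fun h => h^-1 *: (g (h *: w + (h *: v + x)) - g (h *: v + x))).
  apply/funext => h /=; rewrite -scalerDr; congr (_ *: _).
  rewrite scalerDr [h *: v + h *: w]addrC addrA.
  by rewrite -[h *: w + _ + x]addrA; ring.
apply: cvgD; first exact: gv.
apply/cvgrPdist_lt => e e0.
have /nbhs_ballP[d /= d0 Hd] : \forall y \near x,
    derivable g y w /\ `|'D_w g x - 'D_w g y| < e.
  near=> y; split; near: y => //.
  by move/cvgrPdist_lt : cw => /(_ e e0).
pose M := `|v| + `|w| + 1.
have M0 : 0 < M by rewrite ltr_wpDl // addr_ge0.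
rewrite near_withinE; near=> h => h0.
have hM : `|h| < d / M.
  near: h; apply/nbhs_ballP; exists (d / M); first by rewrite /= divr_gt0.
  by move=> z; rewrite /ball /= sub0r normrN.
have Hc c : `|c| <= `|h| -> derivable g (c *: w + (h *: v + x)) w /\
    `|'D_w g x - 'D_w g (c *: w + (h *: v + x))| < e.
  move=> ch; apply: Hd; rewrite -ball_normE /ball_ /=.
  rewrite addrA opprD addrCA subrr addr0 normrN.
  apply: (@le_lt_trans _ _ (`|h| * M)); last by rewrite -ltr_pdivlMr.
  rewrite (le_trans (ler_normD _ _)) // !normrZ /M !mulrDr mulr1.
  rewrite addrC -addrA lerD2l ler_wpDr // ler_wpM2r //.
pose k s := g (s *: w + (h *: v + x)).
have kd s : `|s| <= `|h| -> is_derive s 1 k ('D_w g (s *: w + (h *: v + x))).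
  by move=> sh; apply: is_derive_line; apply: derivableP; have [] := Hc s sh.
have kc a b : `|a| <= `|h| -> `|b| <= `|h| -> {within `[a, b], continuous k}.
  move=> ah bh; apply: derivable_within_continuous => c.
  rewrite in_itv /= => /andP[ac cb].
  have [] // := kd c; move: ah bh; rewrite !ler_norml => /andP[? _] /andP[_ ?].
  by apply/andP; split; [exact: le_trans ac|exact: le_trans cb _].
have [c ch E] : exists2 c, `|c| <= `|h| &
    k h - k 0 = 'D_w g (c *: w + (h *: v + x)) * h.
  have n0 : `|0 : R| <= `|h| by rewrite normr0.
  have [hp|hn] := ltP 0 h.
    have [|||c] := @MVT R k (fun s => 'D_w g (s *: w + (h *: v + x))) 0 h.
    - by [].
    - move=> c; rewrite in_itv /= => /andP[c0 cs]; apply: kd.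
      by rewrite !gtr0_norm // ltW.
    - by apply: kc.
    rewrite in_itv /= => /andP[c0 cs]; rewrite subr0 => E.
    by exists c => //; rewrite !gtr0_norm // ltW.
  have hlt : h < 0 by rewrite lt_neqAle h0.
  have [|||c] := @MVT R k (fun s => 'D_w g (s *: w + (h *: v + x))) h 0.
  - by [].
  - move=> c; rewrite in_itv /= => /andP[c0 cs]; apply: kd.
    by rewrite !ltr0_norm // lerN2 ltW.
  - by apply: kc.
  rewrite in_itv /= => /andP[c0 cs]; rewrite sub0r mulrN => E.
  exists c; first by rewrite !ltr0_norm // lerN2 ltW.
  by rewrite -[LHS]opprB E opprK.
move: E; rewrite /k scale0r add0r => ->.
rewrite [_ *: _]mulrC mulfK //.
by have [] := Hc c ch.
Unshelve. all: by end_near. Qed.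

Lemma is_derive_dirZ V (g : V -> R) (x v : V) (c : R) :
  derivable g x v -> is_derive x (c *: v) g (c * 'D_v g x).
Proof.
move=> gv; apply: is_derive_line0P.
have gv0 : is_derive (c * 0) 1 (fun r : R => g (r *: v + x)) ('D_v g x).
  by rewrite mulr0; apply: is_derive_line0; exact: derivableP.
have dc : is_derive (0 : R) 1 (fun r : R => c * r) c.
  apply: (is_derive_eq (is_deriveZ c (is_derive_id (0 : R) 1))).
  by rewrite [_ *: _]mulr1.
have /is_derive_eq := @is_derive1_comp R (fun r : R => g (r *: v + x))
  (fun r : R => c * r) 0 _ _ gv0 dc.
rewrite mulrC => /(_ _ erefl).
rewrite (_ : _ \o _ = (fun r : R => g (r *: (c *: v) + x))) //.
by apply/funext => r /=; rewrite scalerA mulrC.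
Qed.

End calculus.

(** * Functions of class C^k *)

Section slices.
Variables (R : realType) (V W : normedModType R).

(** Smoothness is assumed jointly in space and time, whereas the geometry of the
graph uses derivatives at a fixed time; this identity transfers them. *)
Lemma growth_rate_slice (g : V * W -> R) (x v : V) (t : W) h :
  g (h *: v + x, t) = g (h *: ((v, 0) : V * W) + (x, t)).
Proof. by congr g; congr pair; rewrite /= scaler0 add0r. Qed.

Lemma derive_slice (g : V * W -> R) (x v : V) (t : W) :
  'D_v (fun y => g (y, t)) x = 'D_(v, 0) g (x, t).
Proof.
rewrite /derive; set F := (X in lim (X @ _) = _).
set G := (X in _ = lim (X @ _)).
suff -> : F = G by [].
by apply/funext => h; rewrite /F /G /= growth_rate_slice.
Qed.

Lemma derivable_slice (g : V * W -> R) (x v : V) (t : W) :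
  derivable g (x, t) (v, 0) -> derivable (fun y => g (y, t)) x v.
Proof.
rewrite /derivable; set G := (X in cvg (X @ _) -> _).
set F := (X in _ -> cvg (X @ _)).
suff -> : F = G by [].
by apply/funext => h; rewrite /F /G /= growth_rate_slice.
Qed.

Lemma Ck_slice (k : nat) (D : set (V * W)) (g : V * W -> R) (t : W) :
  Ck_on k D g -> Ck_on k [set x | D (x, t)] (fun x => g (x, t)).
Proof.
elim: k g => [|k IH] g /= [gc gd]; split => //.
1,2: by move=> x Dx; apply: (@continuous_comp _ _ _ (fun y : V => (y, t)) g);
     [apply: cvg_pair; [exact: cvg_id|exact: cvg_cst]|exact: gc].
move: gd => [gd gk]; split.
  by move=> x v Dx; apply: derivable_slice; exact: gd.
move=> v.
have -> : 'D_v (fun y : V => g (y, t)) = (fun x => 'D_(v, 0) g (x, t)).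
  by apply/funext => x; exact: derive_slice.
by apply: (IH ('D_(v, 0) g)); exact: gk.
Qed.

Lemma derivable_slice2 (g : V * W -> R) (x : V) (t w : W) :
  derivable g (x, t) (0, w) -> derivable (fun s => g (x, s)) t w.
Proof.
rewrite /derivable; set G := (X in cvg (X @ _) -> _).
set F := (X in _ -> cvg (X @ _)).
suff -> : F = G by [].
apply/funext => h; rewrite /F /G /=; congr (_ *: (g _ - _)).
by congr pair; rewrite /= scaler0 add0r.
Qed.

End slices.

Lemma Ck_subset (R : realType) (V : normedModType R) k (D D' : set V) (g : V -> R) :
  D' `<=` D -> Ck_on k D g -> Ck_on k D' g.
Proof.
move=> DD; elim: k g => [|k IH] g /= [gc gd]; split => //.
- by move=> x /DD; exact: gc.
- by move=> x /DD; exact: gc.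
- by case: gd => gd gk; split => [x v /DD|v]; [exact: gd|apply: IH; exact: gk].
Qed.

Section C1.
Variable R : realType.

Lemma C1_is_derive n (D : set 'rV[R]_n) (g : 'rV[R]_n -> R) x w :
  open D -> Ck_on 1 D g -> D x ->
  is_derive x w g (\sum_j w 0 j * 'D_(delta_mx 0 j) g x).
Proof.
move=> oD [gc [gd gk]] Dx.
have nD : \forall y \near x, D y by apply: open_nbhs_nbhs.
rewrite {1}[w]row_sum_delta.
elim: (index_enum 'I_n) => [|j r IH]; first by rewrite !big_nil; exact: is_derive0.
rewrite !big_cons addrC.
have Hj : is_derive x (w 0 j *: delta_mx 0 j) g (w 0 j * 'D_(delta_mx 0 j) g x).
  by apply: is_derive_dirZ; exact: gd.
case: IH => IH1 IH2; rewrite -[in X in is_derive _ _ _ X]IH2.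
have := @is_derive_dirD R _ g x (\sum_(i <- r) w 0 i *: delta_mx 0 i)
   (w 0 j *: delta_mx 0 j) IH1 _ _.
case: Hj => Hj1 Hj2; rewrite Hj2 [in X in _ -> X](addrC _ ('D_ _ _ _)); apply.
  by near=> y; apply: gd; near: y.
by have [kc _] := gk (w 0 j *: delta_mx 0 j); exact: kc.
Unshelve. all: by end_near. Qed.

Lemma Ck_le k n (D : set 'rV[R]_n) (g : 'rV[R]_n -> R) : Ck_on k.+1 D g -> Ck_on k D g.
Proof.
elim: k g => [|k IH] g /= [gc [gd gk]]; split => //; split => // v.
by apply: IH; exact: gk.
Qed.

End C1.

(** * Euclidean geometry of the hemisphere *)

Section euclid.
Variable R : realType.

Lemma edotC n (v w : 'rV[R]_n) : edot v w = edot w v.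
Proof. by apply: eq_bigr => i _; rewrite mulrC. Qed.

Lemma edotDl n (u v w : 'rV[R]_n) : edot (u + v) w = edot u w + edot v w.
Proof. by rewrite -big_split; apply: eq_bigr => i _; rewrite mxE mulrDl. Qed.

Lemma edotZl n (c : R) (v w : 'rV[R]_n) : edot (c *: v) w = c * edot v w.
Proof. by rewrite mulr_sumr; apply: eq_bigr => i _; rewrite mxE mulrA. Qed.

Lemma edotNl n (v w : 'rV[R]_n) : edot (- v) w = - edot v w.
Proof. by rewrite -scaleN1r edotZl mulN1r. Qed.

Lemma edotDr n (u v w : 'rV[R]_n) : edot u (v + w) = edot u v + edot u w.
Proof. by rewrite edotC edotDl !(edotC _ u). Qed.

Lemma edotZr n (c : R) (v w : 'rV[R]_n) : edot v (c *: w) = c * edot v w.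
Proof. by rewrite edotC edotZl edotC. Qed.

Lemma edotNr n (v w : 'rV[R]_n) : edot v (- w) = - edot v w.
Proof. by rewrite edotC edotNl edotC. Qed.

Definition edotE := (edotDl, edotDr, edotZl, edotZr, edotNl, edotNr).

Lemma edot_mulmx n (v w : 'rV[R]_n) : edot v w = (v *m w^T) 0 0.
Proof. by rewrite mxE; apply: eq_bigr => i _; rewrite mxE. Qed.

Lemma edot_ge0 n (v : 'rV[R]_n) : 0 <= edot v v.
Proof. by apply: sumr_ge0 => i _; rewrite -expr2 sqr_ge0. Qed.

Lemma edot_eq0 n (v : 'rV[R]_n) : edot v v = 0 -> v = 0.
Proof.
move=> /eqP; rewrite psumr_eq0 => [/allP v0|i _]; last by rewrite -expr2 sqr_ge0.
apply/rowP => i; rewrite mxE; apply/eqP.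
by have := v0 i (mem_index_enum i); rewrite /= -expr2 sqrf_eq0.
Qed.

Lemma edot_delta n (v : 'rV[R]_n) i : edot v (delta_mx 0 i) = v 0 i.
Proof.
rewrite /edot (bigD1 i) //= big1 ?addr0 ?mxE ?eqxx ?mulr1 // => j ji.
by rewrite !mxE (negbTE ji) mulr0.
Qed.

Lemma enormE n (v : 'rV[R]_n) : enorm v ^+ 2 = edot v v.
Proof. by rewrite sqr_sqrtr // edot_ge0. Qed.

Lemma enormZ n c (v : 'rV[R]_n) : 0 <= c -> enorm (c *: v) = c * enorm v.
Proof.
move=> c0; rewrite /enorm !edotE mulrA -expr2 sqrtrM ?sqr_ge0 //.
by rewrite sqrtr_sqr ger0_norm.
Qed.

Lemma heightZ n c (v : 'rV[R]_n.+1) : height (c *: v) = c * height v.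
Proof. by rewrite /height mxE. Qed.

Lemma halfspace_enorm n (p : 'rV[R]_n.+1) : halfspace p -> 0 < enorm p.
Proof.
move=> p0; rewrite sqrtr_gt0 lt_neqAle edot_ge0 andbT eq_sym.
apply/eqP => /edot_eq0 E; move: p0.
by rewrite E /halfspace /= /height mxE ltxx.
Qed.

Lemma hemisphere_halfspace n (x : 'rV[R]_n.+1) : hemisphere x -> halfspace x.
Proof. by case. Qed.

Lemma hemisphere_edot n (x : 'rV[R]_n.+1) : hemisphere x -> edot x x = 1.
Proof. by case=> x1 _; rewrite -enormE x1 expr1n. Qed.

Lemma sproj_hemisphere n (p : 'rV[R]_n.+1) : halfspace p -> hemisphere (sproj p).
Proof.
move=> p0; have n0 := halfspace_enorm p0; split.
  by rewrite enormZ ?invr_ge0 ?(ltW n0) // mulVf // gt_eqF.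
by rewrite heightZ mulr_gt0 // invr_gt0.
Qed.

Lemma sproj_id n (x : 'rV[R]_n.+1) : hemisphere x -> sproj x = x.
Proof. by case=> x1 _; rewrite /sproj x1 invr1 scale1r. Qed.

Lemma sprojZ n c (p : 'rV[R]_n.+1) : 0 < c -> sproj (c *: p) = sproj p.
Proof.
move=> c0; rewrite /sproj enormZ ?(ltW c0) // scalerA invfM mulrAC mulVf ?mul1r //.
by rewrite gt_eqF.
Qed.

Lemma open_halfspace n : open (@halfspace R n).
Proof.
rewrite /halfspace /height.
have : open ((fun p : 'rV[R]_n.+1 => p 0 ord_max) @^-1` [set y | 0 < y]).
  by apply: open_comp; [move=> p _; exact: coord_continuous|exact: open_gt].
exact.
Qed.

Lemma near_halfspace n (p : 'rV[R]_n.+1) : halfspace p -> \forall q \near p, halfspace q.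
Proof. by move=> p0; apply: open_nbhs_nbhs; split; [exact: open_halfspace|]. Qed.

Lemma near_halfspace_line n (p w : 'rV[R]_n.+1) : halfspace p ->
  \forall s \near (0 : R), halfspace (s *: w + p).
Proof.
move=> p0.
have c : {for (0 : R), continuous (fun s : R => s *: w + p)}.
  by apply: cvgD; [apply: cvgZr_tmp; exact: cvg_id|exact: cvg_cst].
apply: c; rewrite scale0r add0r; exact: near_halfspace.
Qed.

End euclid.

(** * Gradient and Hessian on the hemisphere *)

(** As f o sproj is constant on rays, the restriction of this matrix to the tangent
space is the Hessian of f for the metric of the sphere, and its radial part is
minus the gradient ([shess_radial], [shess_dot_radial]). *)
Definition shess (R : realType) (n : nat) (f : 'rV[R]_n.+1 -> R)
    (x : 'rV[R]_n.+1) : 'M[R]_n.+1 :=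
  \matrix_(l, j) 'D_(delta_mx 0 l) (fun p => sgrad f p 0 j) x.

Section hess.
Variables (R : realType) (n : nat) (f : 'rV[R]_n.+1 -> R).
Hypothesis fC2 : Ck_on 2 (@halfspace R n) (f \o @sproj R n.+1).
Implicit Types p q w x : 'rV[R]_n.+1.

Let fC1 := Ck_le fC2.

Lemma sgradE j : (fun p => sgrad f p 0 j) = 'D_(delta_mx 0 j) (f \o @sproj R n.+1).
Proof. by apply/funext => p; rewrite mxE. Qed.

Lemma sgrad_C1 j : Ck_on 1 (@halfspace R n) (fun p => sgrad f p 0 j).
Proof. by rewrite sgradE; case: fC2 => _ [_]; apply. Qed.

Lemma is_derive_sgrad p w : halfspace p ->
  is_derive p w (f \o @sproj R n.+1) (edot w (sgrad f p)).
Proof.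
move=> p0; have := C1_is_derive w (@open_halfspace R n) fC1 p0.
by rewrite (_ : \sum_j _ = edot w (sgrad f p)) //; apply: eq_bigr => j _; rewrite mxE.
Qed.

Lemma is_derive_shess p w j : halfspace p ->
  is_derive p w (fun q => sgrad f q 0 j) ((w *m shess f p) 0 j).
Proof.
move=> p0; have := C1_is_derive w (@open_halfspace R n) (sgrad_C1 j) p0.
by rewrite mxE (eq_bigr (fun i => w 0 i * shess f p i j)) // => i _; rewrite [in RHS]mxE.
Qed.

Lemma sgrad_radial p : halfspace p -> edot p (sgrad f p) = 0.
Proof.
move=> p0; have [_ <-] := is_derive_sgrad p p0.
rewrite derive_line0 (@near_eq_derive _ _ _ _ (cst (f (sproj p)))) ?derive_cst //.
near=> s; rewrite /= -[p in s *: p + p]scale1r scalerA -scalerDl mulr1 sprojZ //.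
rewrite -ltrBlDr sub0r.
near: s; apply: lt_nbhsr => //; lra.
Unshelve. all: by end_near. Qed.

(** The derivatives of a function homogeneous of degree 0 have degree -1. *)
Lemma sgrad_homog p c : 0 < c -> halfspace p -> sgrad f (c *: p) = c^-1 *: sgrad f p.
Proof.
move=> c0 p0; apply/rowP => j; rewrite !mxE /sdiff derive_line0.
have H : is_derive (c^-1 * 0) 1 (fun s : R => (f \o @sproj R n.+1) (s *: delta_mx 0 j + p))
     ('D_(delta_mx 0 j) (f \o @sproj R n.+1) p).
  rewrite mulr0; apply: is_derive_line0; apply: derivableP.
  by case: fC1 => _ [+ _]; apply.
have L : is_derive (0 : R) 1 (fun s : R => c^-1 * s) c^-1.
  apply: (is_derive_eq (is_deriveZ c^-1 (is_derive_id (0 : R) 1))).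
  by rewrite [_ *: _]mulr1.
rewrite [RHS]mulrC; have [_ <-] := is_derive1_comp H L.
congr (derive _ (0 : R) (1 : R)); apply/funext => s /=; congr f.
rewrite -[RHS](@sprojZ _ _ c) // scalerDr scalerA mulVKf ?gt_eqF //.
Qed.

(** Euler's identity for the gradient, which is homogeneous of degree -1. *)
Lemma shess_radial x : halfspace x -> x *m shess f x = - sgrad f x.
Proof.
move=> x0; apply/rowP => j; have [_ <-] := is_derive_shess x j x0.
rewrite derive_line0.
have := @jet2_affine R 1 1; move=> /(jet2V (oner_neq0 _))[g' [g1 _ g0 _]].
have /is_deriveM : is_derive (0 : R) 1 (fun s : R => (s * 1 + 1)^-1) (-1).
  apply: is_derive_eq (nbhs_singleton g1) _.
  by rewrite g0 invr1 expr1n mulr1.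
move=> /(_ _ _ (is_derive_cst (sgrad f x 0 j) _ _)) [_].
rewrite scaler0 add0r [in X in _ = X -> _]/GRing.scale /= mxE.
rewrite mulrN1 => E; rewrite [RHS]mxE [X in _ = - X]mxE -E.
apply: near_eq_derive.
near=> s; transitivity ((s + 1)^-1 * sgrad f x 0 j); last first.
  by rewrite mxE -[s in LHS]mulr1.
rewrite -[x in s *: x + x]scale1r scalerA -scalerDl mulr1.
rewrite sgrad_homog //; first by rewrite mxE.
rewrite -ltrBlDr sub0r.
near: s; apply: lt_nbhsr => //; lra.
Unshelve. all: by end_near. Qed.

(** Derivative along w of Euler's identity edot p (sgrad f p) = 0. *)
Lemma shess_dot_radial x w : halfspace x -> edot (w *m shess f x) x = - edot w (sgrad f x).
Proof.
move=> x0.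
have dl j : is_derive (0 : R) 1 (fun s : R => (s *: w + x) 0 j) (w 0 j).
  have [g' [g1 _ g0 _]] := @jet2_affine R (x 0 j) (w 0 j).
  have := nbhs_singleton g1; rewrite g0.
  by rewrite (_ : (fun s : R => (s *: w + x) 0 j) = (fun s => s * w 0 j + x 0 j)) //;
     apply/funext => s; rewrite !mxE.
have dg j := is_derive_line0 (is_derive_shess w j x0).
have ds := is_derive_sum (fun j => is_deriveM (dl j) (dg j)).
have E : edot w (sgrad f x) + edot (w *m shess f x) x = 0.
  have [_ /esym] := ds.
  rewrite (@near_eq_derive _ _ _ _ (cst 0)) ?derive_cst.
    move=> <-; rewrite /edot -big_split; apply: eq_bigr => j _ /=.
    by rewrite scale0r add0r /GRing.scale /=; ring.
  near=> s; rewrite fct_sumE /=.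
  suff : edot (s *: w + x) (sgrad f (s *: w + x)) = 0 by [].
  by apply: sgrad_radial; near: s; exact: near_halfspace_line.
by apply/eqP; rewrite -addr_eq0 addrC E.
Unshelve. all: by end_near. Qed.

Lemma graph_jet2 x w : halfspace x ->
  jet2 (fun s : R => f (sproj (s *: w + x))) (f (sproj x)) (edot w (sgrad f x))
    (edot (w *m shess f x) w).
Proof.
move=> x0; exists (fun s => edot w (sgrad f (s *: w + x))); split => //.
- near=> s.
  have H : halfspace (s *: w + x) by near: s; exact: near_halfspace_line.
  exact: is_derive_line (is_derive_sgrad w H).
- by rewrite scale0r add0r.
- by rewrite scale0r add0r.
have dg j := is_derive_line0 (is_derive_shess w j x0).
have ds := is_derive_sum (fun j => is_deriveZ (w 0 j) (dg j)).
apply: (is_derive_eq _ (_ : _ = _)); last first.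
  by rewrite edotC /edot.
rewrite (_ : (fun s => _) = \sum_j (w 0 j \*: (fun r : R => sgrad f (r *: w + x) 0 j))) //.
by apply/funext => s; rewrite fct_sumE.
Unshelve. all: by end_near. Qed.

End hess.

(** * Traces *)

Section linear_algebra.
Variable R : realType.

Lemma edot_mxtrace n (H : 'M[R]_n) (v w : 'rV[R]_n) :
  \tr (H *m (v^T *m w)) = edot (w *m H) v.
Proof. by rewrite mulmxA mxtrace_mulC mulmxA edot_mulmx trace_mx11. Qed.

(** As T maps x into the span of E, it is block triangular in the basis (E, x). *)
Lemma mxtrace_eigenbasis n (T : 'M[R]_n.+1) (E : 'M[R]_(n, n.+1))
    (x : 'rV[R]_n.+1) (mu : 'I_n -> R) :
  row_free E -> (forall i, edot (row i E) x = 0) -> edot x x = 1 ->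
  (forall i, row i E *m T = mu i *: row i E) -> edot (x *m T) x = 0 ->
  \tr T = \sum_i mu i.
Proof.
move=> fE Ex xx ET xTx.
have Ex0 : E *m x^T = 0.
  apply/matrixP => i j; rewrite (ord1 j) [RHS]mxE -(Ex i) edot_mulmx.
  by rewrite -row_mul [in RHS]mxE.
have xx1 : x *m x^T = 1%:M.
  by rewrite [LHS]mx11_scalar -edot_mulmx xx.
pose M := col_mx E x.
have fM : row_free M.
  apply: inj_row_free => y; rewrite -[y]hsubmxK mul_row_col => yM.
  have y2 : rsubmx y = 0.
    have := congr1 (mulmxr x^T) yM.
    by rewrite /= mulmxDl -!mulmxA Ex0 xx1 mulmx0 add0r mulmx1 mul0mx.
  move: yM; rewrite y2 mul0mx addr0 => y1.
  have -> : lsubmx y = 0 by apply: (row_free_inj fE); rewrite y1 mul0mx.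
  by rewrite row_mx0.
have uM : row_full M by apply/eqP; rewrite (eqP fM) addn1.
have [c xT] : exists c, x *m T = c *m E.
  have /submxP[y yE] : (x *m T <= M)%MS by apply: submx_full.
  exists (lsubmx y); move: yE; rewrite -{1}[y]hsubmxK mul_row_col => yE.
  have : rsubmx y = 0.
    have := congr1 (mulmxr x^T) yE.
    rewrite /= mulmxDl -!mulmxA Ex0 xx1 mulmx0 add0r mulmx1 => <-.
    by rewrite mulmxA [LHS]mx11_scalar -edot_mulmx xTx raddf0.
  by move=> y2; rewrite yE y2 mul0mx addr0.
pose B := block_mx (diag_mx (\row_i mu i)) 0 c (0 : 'M[R]_(1, 1)).
have MT : M *m T = B *m M.
  rewrite mul_col_mx mul_block_col !mul0mx !addr0 xT; congr col_mx.
  apply/row_matrixP => i; rewrite row_mul ET row_mul.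
  by rewrite row_diag_mx mxE -scalemxAl -rowE.
rewrite -[T]mul1mx -(mulVpmx uM) -mulmxA mxtrace_mulC MT -mulmxA mulmxVp // mulmx1.
rewrite mxtrace_block mxtrace0 addr0 mxtrace_diag.
by apply: eq_bigr => i _; rewrite mxE.
Qed.

(** The hypothesis on the rows of E says that on the orthogonal complement of x the
form H has eigenvalues mu relative to the metric I + a a^T.  The inverse of this
metric is I - a a^T / (1 + |a|^2); composing with it gives an operator T with
eigenvalues mu in the usual sense, whose trace is computed directly. *)
Lemma sum_relative_eigenvalues n (H : 'M[R]_n.+1) (E : 'M[R]_(n, n.+1))
    (x a : 'rV[R]_n.+1) (mu : 'I_n -> R) :
  row_free E -> (forall i, edot (row i E) x = 0) -> edot x x = 1 ->
  edot a x = 0 -> x *m H = - a ->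
  (forall i, row i E *m H =
     mu i *: (row i E + edot (row i E) a *: a) - edot (row i E) a *: x) ->
  \sum_i mu i = \tr H - edot (a *m H) a / (1 + edot a a).
Proof.
move=> fE Ex xx ax xH EH; set W2 := 1 + edot a a.
have W0 : W2 != 0 by rewrite gt_eqF // ltr_wpDr // edot_ge0.
have rk (v y w : 'rV[R]_n.+1) : v *m (y^T *m w) = edot v y *: w.
  by rewrite mulmxA [v *m _]mx11_scalar mul_scalar_mx edot_mulmx.
(* the rank one term corrects the component of the image along x *)
pose T := H *m (1%:M - W2^-1 *: (a^T *m a)) + a^T *m x.
have TE v : v *m T = v *m H - (W2^-1 * edot (v *m H) a) *: a + edot v a *: x.
  by rewrite mulmxDr mulmxA mulmxBr mulmx1 -scalemxAr !rk scalerA.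
rewrite -(@mxtrace_eigenbasis n T E x mu) //.
- rewrite /T mulmxBr mulmx1 -scalemxAr !raddfD /= raddfN /= linearZ /= edot_mxtrace.
  by rewrite -[a^T *m x]mul1mx edot_mxtrace mulmx1 [edot x a]edotC ax addr0 mulrC.
- move=> i; rewrite TE EH; set e := row i E; set al := edot e a.
  rewrite edotDl edotNl !edotZl edotDl edotZl -/al [edot x a]edotC ax mulr0 subr0.
  rewrite [X in X + _]addrAC subrK scalerDr -addrA -[X in _ = X]addr0; congr (_ + _).
  rewrite scalerA -scalerBl (_ : _ - _ = 0) ?scale0r //.
  rewrite (_ : mu i * (al + al * edot a a) = W2 * (mu i * al)); last by rewrite /W2; ring.
  by rewrite mulKf // subrr.
- by rewrite TE xH !edotE ax !mulr0 ?mulrN ?mulr0 [edot x a]edotC ax mul0r !(oppr0, addr0).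
Qed.

(** The projections of the coordinate vectors form a tight frame of the hyperplane
orthogonal to m: sums over it are traces on this hyperplane. *)
Definition frame n (m : 'rV[R]_n) (j : 'I_n) : 'rV[R]_n :=
  delta_mx 0 j - (m 0 j / edot m m) *: m.

Lemma frame_orth n (m : 'rV[R]_n) j : edot m m != 0 -> edot (frame m j) m = 0.
Proof.
move=> m0; rewrite /frame edotDl edotNl edotZl edotC edot_delta divfK //.
by rewrite subrr.
Qed.

Lemma sum_frame n (m : 'rV[R]_n) (H : 'M[R]_n) : edot m m != 0 ->
  \sum_j edot (frame m j *m H) (frame m j) = \tr H - edot (m *m H) m / edot m m.
Proof.
move=> m0; set W2 := edot m m; set X := edot (m *m H) m.
have E j : edot (frame m j *m H) (frame m j) =
   H j j - (m 0 j * (row j H *m m^T) 0 0) / W2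
    - (m 0 j * (m *m H) 0 j) / W2 + (m 0 j * m 0 j) / W2 * (X / W2).
  rewrite /frame mulmxBl -scalemxAl !(edotDl, edotDr, edotNl, edotNr, edotZl, edotZr).
  rewrite !edot_delta -rowE -/W2 -/X (edot_mulmx (row j H)) [row j H 0 j]mxE. ring.
rewrite (eq_bigr _ (fun j _ => E j)) !big_split /= !sumrN -!mulr_suml.
have -> : \sum_i m 0 i * m 0 i = W2 by [].
have -> : \sum_i m 0 i * (m *m H) 0 i = X by rewrite /X edotC.
have -> : \sum_i m 0 i * (row i H *m m^T) 0 0 = X.
  rewrite /X edot_mulmx (mulmx_sum_row m) mulmx_suml summxE.
  by apply: eq_bigr => i _; rewrite -!scalemxAl [RHS]mxE.
rewrite mulfV // mul1r /mxtrace; ring.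
Qed.

Lemma sum_frame_dot n (m : 'rV[R]_n.+1) : edot m m != 0 ->
  \sum_j edot (frame m j) (frame m j) = n%:R.
Proof.
move=> m0; have := sum_frame 1%:M m0.
rewrite mulmx1 mulfV // mxtrace1 -natr1 addrK => <-.
by apply: eq_bigr => j _; rewrite mulmx1.
Qed.

Lemma sum_frame_sqr n (m y : 'rV[R]_n) : edot m m != 0 ->
  \sum_j edot y (frame m j) ^+ 2 = edot y y - edot y m ^+ 2 / edot m m.
Proof.
move=> m0; have := sum_frame (y^T *m y) m0.
have rk (v w : 'rV[R]_n) : edot (v *m (y^T *m y)) w = edot y v * edot y w.
  by rewrite mulmxA [v *m _]mx11_scalar mul_scalar_mx edotZl -edot_mulmx [edot v y]edotC.
rewrite rk -expr2 -[y^T *m y]mul1mx edot_mxtrace mulmx1 => <-.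
by apply: eq_bigr => j _; rewrite mul1mx rk expr2.
Qed.

End linear_algebra.

(** * Jets of square roots, matrices and norms *)

Section more_jets.
Variable R : realType.

Lemma jet2_is_derive (g : R -> R) a0 a1 a2 : jet2 g a0 a1 a2 -> is_derive (0 : R) 1 g a1.
Proof. by move=> [g' [g1 _ <- _]]; exact: nbhs_singleton g1. Qed.

Lemma is_derive_sqrt (g : R -> R) s (d : R) : 0 < g s -> is_derive s 1 g d ->
  is_derive s 1 (fun r => Num.sqrt (g r)) (d / (2 * Num.sqrt (g s))).
Proof.
move=> g0 gd; rewrite mulrC.
exact: (@is_derive1_comp R Num.sqrt g s _ _ (is_derive1_sqrt g0)).
Qed.

Lemma jet2_sqrt1 (f : R -> R) (a1 a2 : R) : jet2 f 1 a1 a2 ->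
  jet2 (fun s => Num.sqrt (f s)) 1 (a1 / 2) (a2 / 2 - a1 ^+ 2 / 4).
Proof.
move=> [f' [f1 f0 f'0 f2]].
have d1 : is_derive (0 : R) 1 f a1 by rewrite -f'0; exact: nbhs_singleton f1.
have fp : \forall s \near (0 : R), 0 < f s.
  have := near_derivable_continuous f1; rewrite /prop_for /continuous_at f0.
  by move/cvgr_gt; apply.
have s1 : Num.sqrt (f 0) = 1 by rewrite f0 sqrtr1.
exists (fun s => f' s / (2 * Num.sqrt (f s))); split; rewrite ?s1 ?f'0 ?mulr1 //.
  near=> s; apply: is_derive_sqrt; first by near: s.
  by near: s.
have ds : is_derive (0 : R) 1 (fun s => Num.sqrt (f s)) (a1 / 2).
  by have := is_derive_sqrt _ d1; rewrite s1 mulr1 f0; apply.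
have d2s := is_deriveZ 2 ds.
have dV : is_derive (0 : R) 1 (fun s => (2 * Num.sqrt (f s))^-1)
    (- (2 * Num.sqrt (f 0)) ^- 2 *: (2 * (a1 / 2))).
  by apply: is_deriveV => //; rewrite s1 mulr1 pnatr_eq0.
apply: (is_derive_eq (is_deriveM f2 dV)).
rewrite s1 f'0 /GRing.scale /=; field.
Unshelve. all: by end_near. Qed.

Lemma is_derive_mx (V : normedModType R) m n (M : V -> 'M[R]_(m, n)) x v (d : 'M[R]_(m, n)) :
  (forall i j, is_derive x v (fun y => M y i j) (d i j)) -> is_derive x v M d.
Proof.
move=> Md; have dM : derivable M x v by apply/derivable_mxP => i j; case: (Md i j).
apply: DeriveDef => //; rewrite derive_mx //; apply/matrixP => i j; rewrite mxE.
by case: (Md i j).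
Qed.

Lemma enorm_jet2 n (x w : 'rV[R]_n) : edot x x = 1 ->
  jet2 (fun s : R => enorm (s *: w + x)) 1 (edot x w) (edot w w - edot x w ^+ 2).
Proof.
move=> xx.
have H := jet2D (jet2M (jet2_affine 0 1) (jet2_affine (2 * edot x w) (edot w w))) (jet2_cst 1).
have {}H : jet2 (fun s : R => edot (s *: w + x) (s *: w + x)) 1 (2 * edot x w) (2 * edot w w).
  rewrite (_ : (fun s => _) =
      (fun s => (s * 1 + 0) * (s * edot w w + 2 * edot x w) + 1)); last first.
    by apply/funext => s; rewrite !edotE xx [edot w x]edotC; ring.
  by apply: (jet2_eq H); ring.
by apply: (jet2_eq (jet2_sqrt1 H)); field.
Qed.

Lemma enormV_jet2 n (x w : 'rV[R]_n) : edot x x = 1 ->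
  jet2 (fun s : R => (enorm (s *: w + x))^-1) 1 (- edot x w)
    (3 * edot x w ^+ 2 - edot w w).
Proof.
move=> xx; apply: (jet2_eq (jet2V (oner_neq0 _) (enorm_jet2 w xx))).
- exact: invr1.
- by rewrite invr1 expr1n mulr1.
- by rewrite invr1 !expr1n; ring.
Qed.

Lemma coord_jet2 n (x w : 'rV[R]_n) j :
  jet2 (fun s : R => (s *: w + x) 0 j) (x 0 j) (w 0 j) 0.
Proof.
have := @jet2_affine R (x 0 j) (w 0 j).
rewrite (_ : (fun s => (s *: w + x) 0 j) = (fun s => s * w 0 j + x 0 j)) //.
by apply/funext => s; rewrite !mxE.
Qed.

End more_jets.

(** * The hyperbolic metric *)

Section hyperbolic.
Variables (R : realType) (n : nat).
Implicit Types p v w : 'rV[R]_n.+1.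

Lemma hinnerE p v w : hinner p v w = height p ^- 2 * edot v w.
Proof.
by rewrite /hinner /hmetric mul_mx_scalar -scalemxAl mxE edot_mulmx.
Qed.

Lemma derive_hmetric p (i j l : 'I_n.+1) : halfspace p ->
  'D_(delta_mx 0 i) (fun q => hmetric q j l) p =
  - 2 * height p ^- 3 * (i == ord_max)%:R * (j == l)%:R.
Proof.
move=> p0; have y0 : height p != 0 by rewrite gt_eqF.
rewrite derive_line0.
have H := coord_jet2 p (delta_mx 0 i) ord_max.
have {}H := jet2M H H.
have {}H := jet2V (mulf_neq0 y0 y0) H.
have /jet2_is_derive[_ E] := jet2M H (jet2_cst (j == l)%:R).
rewrite (_ : (fun r => _) = (fun s : R => ((s *: delta_mx 0 i + p) 0 ord_max
    * (s *: delta_mx 0 i + p) 0 ord_max)^-1 * (j == l)%:R)); last first.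
  by apply/funext => s; rewrite /hmetric mxE mulr_natr expr2.
rewrite E mulr0 addr0 [delta_mx 0 i 0 ord_max]mxE /= eq_sym -/(height p).
by congr (_ * _); field.
Qed.

Lemma christoffel_hmetric p (k i j : 'I_n.+1) : halfspace p ->
  christoffel (@hmetric R n) p k i j = - (height p)^-1 *
   ((i == ord_max)%:R * (j == k)%:R + (j == ord_max)%:R * (i == k)%:R
     - (k == ord_max)%:R * (i == j)%:R).
Proof.
move=> p0; have y0 : height p != 0 by rewrite gt_eqF.
rewrite /christoffel (bigD1 k) //= [X in _ + X]big1 ?addr0.
  by rewrite !derive_hmetric // /hmetric invmx_scalar mxE eqxx mulr1n; field.
by move=> l lk; rewrite invmx_scalar mxE eq_sym (negbTE lk) mul0r.
Qed.

Lemma christoffel_sum p v w : halfspace p ->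
  \row_k \sum_i \sum_j christoffel (@hmetric R n) p k i j * v 0 i * w 0 j =
  - (height p)^-1 *: (height v *: w + height w *: v - edot v w *: delta_mx 0 ord_max).
Proof.
move=> p0; apply/rowP => k; rewrite !mxE.
have E i j : christoffel (@hmetric R n) p k i j * v 0 i * w 0 j =
  - (height p)^-1 * (((i == ord_max)%:R * v 0 i) * ((j == k)%:R * w 0 j))
  + - (height p)^-1 * (((i == k)%:R * v 0 i) * ((j == ord_max)%:R * w 0 j))
  + (height p)^-1 * (k == ord_max)%:R * (((i == j)%:R * v 0 i) * w 0 j).
  by rewrite christoffel_hmetric //; ring.
under eq_bigr do under eq_bigr do rewrite E.
have D (u : 'rV[R]_n.+1) l : \sum_i (i == l)%:R * u 0 i = u 0 l.
  rewrite (bigD1 l) //= big1 ?addr0 ?eqxx ?mul1r // => i il.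
  by rewrite (negbTE il) mul0r.
have D2 : \sum_i \sum_j (i == j)%:R * v 0 i * w 0 j = edot v w.
  apply: eq_bigr => i _; rewrite (bigD1 i) //= big1 ?addr0 ?eqxx ?mul1r // => j ji.
  by rewrite eq_sym (negbTE ji) !mul0r.
under eq_bigr do rewrite !big_split /= -!mulr_sumr.
rewrite !big_split /= -!mulr_sumr -!mulr_suml !D D2 /height /=; ring.
Qed.

End hyperbolic.

(** * Mean curvature of a radial graph *)

Section graph.
Variables (R : realType) (n : nat) (f : 'rV[R]_n.+1 -> R).
Hypothesis fC2 : Ck_on 2 (@halfspace R n) (f \o @sproj R n.+1).
Implicit Types x w : 'rV[R]_n.+1.

Lemma is_derive_radial_graph x w : hemisphere x -> edot w x = 0 ->
  is_derive x w (radial_graph f \o @sproj R n.+1)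
    (expR (f x) *: (w + edot w (sgrad f x) *: x)).
Proof.
move=> Sx wx; have hx := hemisphere_halfspace Sx; have xx := hemisphere_edot Sx.
apply: is_derive_mx => i j; rewrite (ord1 i) {i}; apply: is_derive_line0P.
have H := jet2M (jet2_exp (graph_jet2 fC2 w hx))
  (jet2M (enormV_jet2 w xx) (coord_jet2 x w j)).
rewrite (_ : (fun r : R => _) = (fun s : R => expR (f (sproj (s *: w + x))) *
   ((enorm (s *: w + x))^-1 * (s *: w + x) 0 j))); last first.
  by apply/funext => s; rewrite mxE /= mxE [in LHS]mulrA [in RHS]mulrA.
apply: (is_derive_eq (jet2_is_derive H)).
by rewrite sproj_id // [edot x w]edotC wx !mxE; ring.
Qed.

Variable N : 'rV[R]_n.+1 -> 'rV[R]_n.+1.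
Hypothesis Nn : upward_unit_normal (radial_graph f) N.

(** A vector orthogonal to all e^f (w + (w.a) x) with w tangent is a multiple of
x - a; the norm and the orientation determine the factor. *)
Lemma unit_normalE x : hemisphere x ->
  N x = (expR (f x) * height x / Num.sqrt (1 + edot (sgrad f x) (sgrad f x)))
    *: (x - sgrad f x).
Proof.
move=> Sx; have hx := hemisphere_halfspace Sx; have xx := hemisphere_edot Sx.
have [N1 N2 N3] := Nn Sx; set a := sgrad f x; set b := edot (N x) x.
have ax : edot x a = 0 by apply: sgrad_radial.
have e0 := expR_gt0 (f x).
have y0 : 0 < height (radial_graph f x) by rewrite heightZ mulr_gt0.
have bE : N x = b *: (x - a).
  pose z := N x - b *: x + b *: a.
  have zx : edot z x = 0 by rewrite /z !edotE xx [edot a x]edotC ax /b; ring.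
  have zE : z = N x - b *: x + b *: a by [].
  clearbody z.
  have Nz : edot (N x) (z + edot z a *: x) = 0.
    have := N2 z zx; rewrite /sdiff (derive_val (is_derive := is_derive_radial_graph Sx zx)).
    rewrite hinnerE edotZr => /eqP.
    rewrite !mulf_eq0 invr_eq0 expf_eq0 /= gt_eqF // gt_eqF //= => /eqP; exact.
  have : edot z z = 0.
    rewrite -{}Nz {2}zE !edotE zx -/b.
    by rewrite [edot z (N x)]edotC; ring.
  move/edot_eq0; rewrite zE => /eqP; rewrite -addrA addr_eq0 => /eqP ->.
  by rewrite scalerBr opprD opprK.
have b0 : 0 < b.
  move: N3; rewrite hinnerE edotZr pmulr_rgt0 ?invr_gt0 ?exprn_gt0 //.
  by rewrite pmulr_rgt0.
have W0 : 0 < 1 + edot a a by rewrite ltr_wpDr // edot_ge0.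
have bW : b ^+ 2 * (1 + edot a a) = height (radial_graph f x) ^+ 2.
  move: N1; rewrite hinnerE bE !edotE xx [edot a x]edotC ax => /(congr1 ( *%R (height (radial_graph f x) ^+ 2))).
  rewrite mulVKf ?mulr1 => [<-|]; first by ring.
  by rewrite expf_neq0 // gt_eqF.
rewrite {1}bE; congr (_ *: _).
rewrite -heightZ -/(radial_graph f x).
have Wp : 0 < Num.sqrt (1 + edot a a) by rewrite sqrtr_gt0.
apply/eqP; rewrite -(@eqrXn2 _ 2) //; [|exact: ltW|by rewrite ltW // divr_gt0].
rewrite expr_div_n sqr_sqrtr; last exact: ltW.
by rewrite -bW mulfK // gt_eqF.
Qed.

(** The derivative of the scalar factor of the normal is left unspecified: it
multiplies x - a, and it is eliminated in [principal_direction] by taking the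
inner product with x. *)
Lemma is_derive_unit_normal x w : hemisphere x -> edot w x = 0 ->
  exists c : R, is_derive x w (N \o @sproj R n.+1)
    (c *: (x - sgrad f x) +
     (expR (f x) * height x / Num.sqrt (1 + edot (sgrad f x) (sgrad f x))) *:
       (w - w *m shess f x)).
Proof.
move=> Sx wx; have hx := hemisphere_halfspace Sx; have xx := hemisphere_edot Sx.
pose rho s : R := enorm (s *: w + x).
pose W2 s : R := 1 + (rho s * rho s) * \sum_j sgrad f (s *: w + x) 0 j * sgrad f (s *: w + x) 0 j.
pose c s := expR (f (sproj (s *: w + x))) * ((rho s)^-1 * (s *: w + x) 0 ord_max) / Num.sqrt (W2 s).
have dg j := is_derive_line0 (is_derive_shess fC2 w j hx).
have drho : is_derive (0 : R) 1 rho 0.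
  by apply: (is_derive_eq (jet2_is_derive (enorm_jet2 w xx))); rewrite edotC.
have drhoV : is_derive (0 : R) 1 (fun s => (rho s)^-1) 0.
  apply: (is_derive_eq (jet2_is_derive (enormV_jet2 w xx))).
  by rewrite edotC wx oppr0.
have rho0 : rho 0 = 1 by rewrite /rho scale0r add0r; case: Sx.
have W20 : W2 0 = 1 + edot (sgrad f x) (sgrad f x).
  by rewrite /W2 rho0 scale0r add0r !mul1r.
have W0 : 0 < W2 0 by rewrite W20 ltr_wpDr // edot_ge0.
have [d2 dW2] : exists d, is_derive (0 : R) 1 W2 d.
  have H1 := is_derive_sum (fun j => is_deriveM (dg j) (dg j)).
  have H2 := is_deriveD (is_derive_cst (1 : R) (0 : R) 1) (is_deriveM (is_deriveM drho drho) H1).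
  eexists; apply: (is_derive_eq _ erefl).
  move: H2; set G := (X in is_derive _ _ X _) => H2.
  suff -> : W2 = G by exact: H2.
  apply/funext => s.
  transitivity (1 + rho s * rho s * (\sum_i (fun r : R => sgrad f (r *: w + x) 0 i) *
            (fun r : R => sgrad f (r *: w + x) 0 i)) s); last by [].
  by rewrite fct_sumE.
have [d1 dc] : exists d, is_derive (0 : R) 1 c d.
  have H1 := jet2_is_derive (jet2_exp (graph_jet2 fC2 w hx)).
  have H2 := is_deriveM drhoV (jet2_is_derive (coord_jet2 x w ord_max)).
  have H3 := is_derive_sqrt W0 dW2.
  have S0 : Num.sqrt (W2 0) != 0 by rewrite gt_eqF // sqrtr_gt0.
  have H4 := @is_deriveV R (fun r => Num.sqrt (W2 r)) 0 _ 1 S0 H3.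
  by eexists; exact: (is_deriveM (is_deriveM H1 H2) H4).
have c0 : c 0 = expR (f x) * height x / Num.sqrt (1 + edot (sgrad f x) (sgrad f x)).
  by rewrite /c W20 rho0 scale0r add0r sproj_id // invr1 mul1r.
exists d1; apply: is_derive_mx => i j; rewrite (ord1 i) {i}; apply: is_derive_line0P.
have H5 := is_deriveB (is_deriveM drhoV (jet2_is_derive (coord_jet2 x w j)))
  (is_deriveM drho (dg j)).
have H6 := is_deriveM dc H5.
have := is_derive_eq H6 (_ : _ = (d1 *: (x - sgrad f x) +
     (expR (f x) * height x / Num.sqrt (1 + edot (sgrad f x) (sgrad f x))) *:
       (w - w *m shess f x)) 0 j).
move=> /(_ _)/near_eq_is_derive; apply.
- near=> s.
  have hs : halfspace (s *: w + x) by near: s; exact: near_halfspace_line.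
  have r0 : 0 < rho s by exact: halfspace_enorm.
  rewrite /= unit_normalE; last exact: sproj_hemisphere.
  have -> : sgrad f (sproj (s *: w + x)) = rho s *: sgrad f (s *: w + x).
    by rewrite sgrad_homog ?invrK // invr_gt0.
  set fs := f (sproj _).
  have -> : sproj (s *: w + x) = (rho s)^-1 *: (s *: w + x) by [].
  rewrite heightZ !edotE [LHS]/(c s * ((rho s)^-1 * (s *: w + x) 0 j
      - rho s * sgrad f (s *: w + x) 0 j)) [RHS]mxE; congr (_ * _).
    by rewrite [rho s * (_ * _)]mulrA.
  by rewrite !mxE.
- rewrite c0 rho0 /=; set cc := _ / _.
  rewrite -![((_ - _ : _ -> _) _)]/(_ - _) -![((_ * _ : _ -> _) _)]/(_ * _).
  rewrite rho0 (scale0r w) (add0r x) invr1.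
  transitivity (d1 * (x 0 j - sgrad f x 0 j) + cc * (w 0 j - (w *m shess f x) 0 j)).
    by rewrite /GRing.scale /=; ring.
  by rewrite !mxE.
Unshelve. all: by end_near. Qed.

(** The Levi-Civita derivative of N differs from the Euclidean one by multiples of N
and of the image of w, so that the eigenvalue equation only involves w, x, a and
the image of w under the Hessian.  The shift of k in mu comes from the conformal
factor. *)
Lemma principal_direction x w k : hemisphere x -> edot w x = 0 ->
  - hconn (radial_graph f) N x w = k *: sdiff (radial_graph f) x w ->
  let a := sgrad f x in
  let mu := 1 + (k * Num.sqrt (1 + edot a a) - height (x - a)) / height x in
  w *m shess f x = mu *: (w + edot w a *: a) - edot w a *: x.
Proof.
move=> Sx wx hk a mu.
have hx := hemisphere_halfspace Sx; have xx := hemisphere_edot Sx.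
have [_ N2 _] := Nn Sx.
have ax : edot x a = 0 by apply: sgrad_radial.
have e0 := expR_gt0 (f x).
have y0 : 0 < height (radial_graph f x) by rewrite heightZ mulr_gt0.
have [c1 [_ dN]] := is_derive_unit_normal Sx wx.
have [_ dF] := is_derive_radial_graph Sx wx.
move: hk; rewrite /hconn christoffel_sum //.
have -> : edot (sdiff (radial_graph f) x w) (N x) = 0.
  have := N2 w wx; rewrite hinnerE edotC => /eqP; rewrite mulf_eq0 invr_eq0 expf_eq0 /=.
  by rewrite gt_eqF //= => /eqP.
rewrite scale0r subr0 unit_normalE // /sdiff dN dF -/a !heightZ.
set W := Num.sqrt _ in mu *; set hW := w *m shess f x; set al := edot w a.
have W0 : 0 < W by rewrite sqrtr_gt0 ltr_wpDr // edot_ge0.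
set E := expR (f x) in e0 y0 *.
have hx0 : 0 < height x by [].
have hWx : edot hW x = - al by exact: shess_dot_radial.
set X := height x in hx0 mu *; set M := height (x - a) in mu *.
set V := height (w + al *: x).
move=> eq.
have Ej j : - (c1 * (x 0 j - a 0 j) + E * X / W * (w 0 j - hW 0 j)
    - (E * X)^-1 * (E * V * (E * X / W * (x 0 j - a 0 j))
       + E * X / W * M * (E * (w 0 j + al * x 0 j)))) =
   k * (E * (w 0 j + al * x 0 j)).
  by move/rowP: eq => /(_ j); rewrite !mxE => <-; ring.
have Ex : - (c1 + E * X / W * al
    - (E * X)^-1 * (E * V * (E * X / W) + E * X / W * M * (E * al))) = k * (E * al).
  have := congr1 (fun z => edot z x) eq.
  rewrite !edotE xx wx hWx [edot a x]edotC ax => E1.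
  rewrite (_ : k * (E * al) = k * (E * (0 + al * 1))); last by ring.
  rewrite -E1; ring.
have c1E : c1 = - (k * (E * al)) - E * X / W * al
    + (E * X)^-1 * (E * V * (E * X / W) + E * X / W * M * (E * al)).
  by rewrite -Ex; ring.
apply/rowP => j.
transitivity (mu * (w 0 j + al * a 0 j) - al * x 0 j); last by rewrite !mxE.
have {Ej} := Ej j; rewrite c1E => Ej.
have : E * X / W * hW 0 j = E * X / W * (mu * (w 0 j + al * a 0 j) - al * x 0 j).
  have -> : E * X / W * hW 0 j = k * (E * (w 0 j + al * x 0 j)) - (
    - (c1 * (x 0 j - a 0 j) + E * X / W * w 0 j
    - (E * X)^-1 * (E * V * (E * X / W * (x 0 j - a 0 j))
       + E * X / W * M * (E * (w 0 j + al * x 0 j))))).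
    by rewrite -Ej c1E; ring.
  rewrite c1E /mu; field.
  by rewrite !gt_eqF.
by apply: mulfI; rewrite gt_eqF // divr_gt0 // mulr_gt0.
Qed.

(** The vector m = x - a is normal to the graph, so that the sum over its frame is
the trace over the tangent space of the Hessian of f - log |.|, of which the graph
is a dilated level set.  Both sides are expressed by the trace of the Hessian of f
relative to I + a a^T, which [principal_direction] computes in a principal basis. *)
Lemma graph_mean_curvature x H : (0 < n)%N -> hemisphere x ->
  mean_curvature (radial_graph f) N x H ->
  let a := sgrad f x in let m := x - a in
  n%:R * (Num.sqrt (1 + enorm a ^+ 2) * H) =
    height x * (\sum_j (edot (frame m j *m shess f x) (frame m j)
        - edot (frame m j) (frame m j) + 2 * edot x (frame m j) ^+ 2))
    + n%:R * height m.
Proof.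
move=> n0 Sx [k [E [fE Ex Ek]] ->] a m.
have hx := hemisphere_halfspace Sx; have xx := hemisphere_edot Sx.
have ax : edot x a = 0 by apply: sgrad_radial.
rewrite enormE; set W := Num.sqrt _.
have W20 : 0 < 1 + edot a a by rewrite ltr_wpDr // edot_ge0.
have mm : edot m m = 1 + edot a a by rewrite !edotE xx [edot a x]edotC ax; ring.
have xm : edot x m = 1 by rewrite !edotE xx ax; ring.
have hx0 : 0 < height x by [].
have mu := fun i => principal_direction Sx (Ex i) (Ek i).
have ax' : edot a x = 0 by rewrite edotC.
have := sum_relative_eigenvalues fE Ex xx ax' (shess_radial fC2 hx) mu.
rewrite -/a -/W big_split /= sumr_const card_ord -mulr_suml sumrB -mulr_suml.
rewrite sumr_const card_ord -/m => tr.
rewrite !big_split /= sumrN -mulr_sumr sum_frame ?sum_frame_dot ?sum_frame_sqr ?mm ?gt_eqF //.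
rewrite xx xm.
have xa : edot (x *m shess f x) a = - edot a a by rewrite shess_radial // edotNl.
have xhx : edot (x *m shess f x) x = 0 by rewrite shess_radial // edotNl ax' oppr0.
have ahx : edot (a *m shess f x) x = - edot a a by rewrite shess_dot_radial.
have -> : edot (m *m shess f x) m = 2 * edot a a + edot (a *m shess f x) a.
  rewrite /m mulmxBl !edotE xhx xa ahx; ring.
have nn : n%:R != 0 :> R by rewrite pnatr_eq0 -lt0n.
have -> : \tr (shess f x) = n%:R + ((\sum_i k i) * W - n%:R * height m) / height x
    + edot (a *m shess f x) a / (1 + edot a a).
  by rewrite -[LHS](subrK (edot (a *m shess f x) a / (1 + edot a a))) -tr mulr_natl.
by field; rewrite nn !gt_eqF.
Qed.

End graph.

(** * The flow equation and the barrier *)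

Section flow.
Variables (R : realType) (n : nat) (u : 'rV[R]_n.+1 -> R -> R).
Hypothesis hu : graphical_solution +oo%E u.

Lemma flow_C2 t : 0 < t -> Ck_on 2 (@halfspace R n) (u^~ t \o @sproj R n.+1).
Proof.
move=> t0; have [_ us _ _] := hu.
apply: Ck_subset (Ck_slice t (us 2)) => x hx /=; split => //; exact: ltry.
Qed.

Lemma flow_is_derive (x : 'rV[R]_n.+1) (t : R) : hemisphere x -> 0 < t -> is_derive t 1 (u x) (derive1 (u x) t).
Proof.
move=> Sx t0; have [_ us _ _] := hu.
rewrite derive1E; apply: derivableP.
rewrite (_ : u x = (fun s => u (sproj x) s)); last by rewrite sproj_id.
apply: (@derivable_slice2 _ _ _ (fun z : 'rV[R]_n.+1 * R => u (sproj z.1) z.2) x t 1).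
have [_ [+ _]] := us 2; apply; split => //; first exact: hemisphere_halfspace.
exact: ltry.
Qed.

Lemma flow_equation (x : 'rV[R]_n.+1) (t : R) : (0 < n)%N -> hemisphere x -> 0 < t ->
  let f := u^~ t in let m := x - sgrad f x in
  n%:R * derive1 (u x) t = height x * (height x *
    (\sum_j (edot (frame m j *m shess f x) (frame m j)
        - edot (frame m j) (frame m j) + 2 * edot x (frame m j) ^+ 2))
    + n%:R * height m).
Proof.
move=> n0 Sx t0 f m; have [_ _ _ hcurv] := hu.
have [//|N Nn /(_ x Sx)[H HN ->]] := hcurv t t0; first exact: ltry.
rewrite -(graph_mean_curvature (flow_C2 t0) Nn n0 Sx HN) -/f; ring.
Qed.

End flow.

Section barrier.
Variables (R : realType) (sg B al ka b : R).

(** Here y and r stand for the height and the squared Euclidean norm of a point.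
The first term is the height of the point after the translation by -t, the
second one a Gaussian in the horizontal part of the translated point, whose
squared norm is expR (- 2 * t) * (r - y * y), and the last one a penalization
that blows up at the ideal boundary. *)
Definition barrier (t y r : R) : R :=
  sg * (expR (- t) * y) - B * expR (- 2 * al * t - ka * expR (- 2 * t) * (r - y * y))
  - b * expR (3 * t) * (r + y^-1).

Let G t y r := expR (- 2 * al * t - ka * expR (- 2 * t) * (r - y * y)).

Definition barrier_y (t y r : R) := sg * expR (- t)
  - B * G t y r * (2 * ka * expR (- 2 * t) * y) + b * expR (3 * t) * y^-1 ^+ 2.
Definition barrier_r (t y r : R) := B * G t y r * (ka * expR (- 2 * t)) - b * expR (3 * t).
Definition barrier_t (t y r : R) := - sg * (expR (- t) * y)
  + B * G t y r * (2 * al - 2 * ka * expR (- 2 * t) * (r - y * y))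
  - 3 * b * expR (3 * t) * (r + y^-1).

Lemma jet2_barrier t (y r : R -> R) y0 y1 y2 r0 r1 r2 : y0 != 0 ->
  jet2 y y0 y1 y2 -> jet2 r r0 r1 r2 ->
  jet2 (fun s => barrier t (y s) (r s)) (barrier t y0 r0)
    (barrier_y t y0 r0 * y1 + barrier_r t y0 r0 * r1)
    (barrier_y t y0 r0 * y2 + barrier_r t y0 r0 * r2
     - B * G t y0 r0 * (2 * ka * expR (- 2 * t) * y1 ^+ 2
           + (ka * expR (- 2 * t)) ^+ 2 * (r1 - 2 * y0 * y1) ^+ 2)
     - b * expR (3 * t) * (2 * y1 ^+ 2 * y0^-1 ^+ 3)).
Proof.
move=> y0n jy jr.
have J1 := jet2M (jet2_cst sg) (jet2M (jet2_cst (expR (- t))) jy).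
have J2 := jet2D jr (jet2M (jet2_cst (-1)) (jet2M jy jy)).
have J3 := jet2D (jet2_cst (- 2 * al * t)) (jet2M (jet2_cst (- (ka * expR (- 2 * t)))) J2).
have J4 := jet2M (jet2_cst (- B)) (jet2_exp J3).
have J5 := jet2M (jet2_cst (- (b * expR (3 * t)))) (jet2D jr (jet2V y0n jy)).
have J := jet2D (jet2D J1 J4) J5.
have E s z : sg * (expR (- t) * s)
  + - B * expR (- 2 * al * t + - (ka * expR (- 2 * t)) * (z + -1 * (s * s)))
  + - (b * expR (3 * t)) * (z + s^-1) = barrier t s z.
  rewrite /barrier (_ : - 2 * al * t + - (ka * expR (- 2 * t)) * (z + -1 * (s * s)) =
    - 2 * al * t - ka * expR (- 2 * t) * (z - s * s)); ring.
have EG : expR (- 2 * al * t + - (ka * expR (- 2 * t)) * (r0 + -1 * (y0 * y0))) = G t y0 r0.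
  by rewrite /G; congr expR; ring.
rewrite (_ : (fun s => barrier t (y s) (r s)) = (fun s => sg * (expR (- t) * y s)
  + - B * expR (- 2 * al * t + - (ka * expR (- 2 * t)) * (r s + -1 * (y s * y s)))
  + - (b * expR (3 * t)) * (r s + (y s)^-1))); last first.
  by apply/funext => s; rewrite E.
apply: (jet2_eq J); first exact: E.
- rewrite EG /barrier_y /barrier_r; ring.
- rewrite EG /barrier_y /barrier_r; ring.
Qed.

Lemma is_derive_barrier (y r : R -> R) (t y' r' : R) : y t != 0 ->
  is_derive t 1 y y' -> is_derive t 1 r r' ->
  is_derive t 1 (fun s => barrier s (y s) (r s))
    (barrier_t t (y t) (r t) + barrier_y t (y t) (r t) * y' + barrier_r t (y t) (r t) * r').
Proof.
move=> yn dy dr.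
have dl c : is_derive t 1 (fun s : R => c * s) c.
  by apply: (is_derive_eq (is_deriveZ c (is_derive_id t 1))); rewrite [_ *: _]mulr1.
have de c : is_derive t 1 (fun s : R => expR (c * s)) (c * expR (c * t)).
  exact: is_derive_exp (dl c).
have dN : is_derive t 1 (fun s : R => expR (- s)) (- expR (- t)).
  have := is_derive_exp (is_deriveN (is_derive_id t 1)).
  by rewrite mulN1r; apply.
have M (f g : R -> R) (f' g' : R) : is_derive t 1 f f' -> is_derive t 1 g g' ->
    is_derive t 1 (fun s => f s * g s) (f' * g t + f t * g').
  by move=> df dg; apply: (is_derive_eq (is_deriveM df dg)); rewrite /GRing.scale /=; ring.
have A (f g : R -> R) (f' g' : R) : is_derive t 1 f f' -> is_derive t 1 g g' ->
    is_derive t 1 (fun s => f s + g s) (f' + g').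
  by move=> df dg; exact: is_deriveD.
have V : is_derive t 1 (fun s => (y s)^-1) (- y' * (y t)^-1 ^+ 2).
  by apply: (is_derive_eq (is_deriveV yn dy)); rewrite -exprVn /GRing.scale /=; ring.
have C (c : R) := is_derive_cst c t (1 : R).
have D1 := M _ _ _ _ (C sg) (M _ _ _ _ dN dy).
have D2 := A _ _ _ _ dr (M _ _ _ _ (C (-1)) (M _ _ _ _ dy dy)).
have D3 := A _ _ _ _ (dl (- 2 * al)) (M _ _ _ _ (M _ _ _ _ (C (- ka)) (de (- 2))) D2).
have D4 := M _ _ _ _ (C (- B)) (is_derive_exp D3).
have D5 := M _ _ _ _ (M _ _ _ _ (C (- b)) (de 3)) (A _ _ _ _ dr V).
have EG s : - 2 * al * s + - ka * expR (- 2 * s) * (r s + -1 * (y s * y s)) =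
   - 2 * al * s - ka * expR (- 2 * s) * (r s - y s * y s) by ring.
rewrite (_ : (fun s => _) = (fun s => sg * (expR (- s) * y s)
  + - B * expR (- 2 * al * s + - ka * expR (- 2 * s) * (r s + -1 * (y s * y s)))
  + - b * expR (3 * s) * (r s + (y s)^-1))); last first.
  by apply/funext => s; rewrite EG /barrier; ring.
apply: (is_derive_eq (A _ _ _ _ (A _ _ _ _ D1 D4) D5)).
rewrite EG /barrier_t /barrier_y /barrier_r /G /cst; ring.
Qed.

End barrier.

Section no_max.
Variables (R : realType) (n : nat) (u : 'rV[R]_n.+1 -> R -> R).
Hypothesis hu : graphical_solution +oo%E u.
Implicit Types (x w : 'rV[R]_n.+1) (t : R).

(** The quantities y and r of [barrier] at the point e^(u(x, t)) x of the moving graph. *)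
Definition gheight x t : R := expR (u x t) * height x.
Definition gsqnorm x t : R := expR (u x t) * expR (u x t).

Lemma gheight_gt0 x t : hemisphere x -> 0 < gheight x t.
Proof. by move=> [_ x0]; rewrite mulr_gt0 // expR_gt0. Qed.

Lemma gsqnorm_jet2 x w t : hemisphere x -> 0 < t ->
  let E := expR (u x t) in let f := u^~ t in
  let al := edot w (sgrad f x) in let be := edot (w *m shess f x) w in
  jet2 (fun s : R => gsqnorm (sproj (s *: w + x)) t)
  (E * E) (2 * al * (E * E)) ((2 * be + 4 * al ^+ 2) * (E * E)).
Proof.
move=> Sx t0 E f al be.
have H := jet2_exp (graph_jet2 (flow_C2 hu t0) w (hemisphere_halfspace Sx)).
by apply: (jet2_eq (jet2M H H)); rewrite sproj_id // -/f -/al -/be -/E; ring.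
Qed.

(** The curves s |-> x + s w leave the hemisphere and are brought back by sproj, whence
the terms in xi and om.  The first derivative is E * height w exactly when w is
orthogonal to x - sgrad f x. *)
Lemma gheight_jet2 x w t : hemisphere x -> 0 < t ->
  let E := expR (u x t) in let f := u^~ t in
  let al := edot w (sgrad f x) in let be := edot (w *m shess f x) w in
  let xi := edot x w in let om := edot w w in
  jet2 (fun s : R => gheight (sproj (s *: w + x)) t)
  (E * height x) (E * (al - xi) * height x + E * height w)
  (E * (be + al ^+ 2 - 2 * al * xi + 3 * xi ^+ 2 - om) * height x
     + 2 * (E * (al - xi)) * height w).
Proof.
move=> Sx t0 E f al be xi om.
have H := jet2_exp (graph_jet2 (flow_C2 hu t0) w (hemisphere_halfspace Sx)).
have H2 := jet2M (enormV_jet2 w (hemisphere_edot Sx)) (coord_jet2 x w ord_max).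
have := jet2M H H2.
rewrite (_ : (fun s => _) = (fun s : R => gheight (sproj (s *: w + x)) t)); last first.
  by apply/funext => s; rewrite /gheight heightZ.
move/jet2_eq; apply; rewrite sproj_id // -/f -/al -/be -/E /height /xi /om; ring.
Qed.

(** At such a maximum, the first order condition says that the gradient of the barrier
is normal to the graph, and the second order conditions along the frame of the
tangent space sum up to a bound on the curvature term of the flow equation.  Both
enter the condition in time, and there results an inequality ([star]) in which u
only appears through the height and the norm of the point.  The height term of the
barrier cancels, the Gaussian contributes a nonpositive amount by the bounds on q,
and the penalization a negative one. *)
Lemma flow_no_interior_max (sg B al ka b : R) x t :
  (0 < n)%N -> hemisphere x -> 0 < t -> 0 < b -> 0 <= B -> 0 <= ka ->
  let q := expR (- t) * gheight x t in
  (0 < B -> n%:R * al <= ka * (n%:R - 1) * q ^+ 2 /\ 2 * ka * q ^+ 2 <= n%:R) ->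
  let Psi x t := barrier sg B al ka b t (gheight x t) (gsqnorm x t) in
  (forall x', hemisphere x' -> Psi x' t <= Psi x t) ->
  (forall t', 0 <= t' <= t -> Psi x t' <= Psi x t) -> False.
Proof.
move=> n0 Sx t0 b0 B0 ka0 q hB Psi smax tmax.
have hx := hemisphere_halfspace Sx; have xx := hemisphere_edot Sx.
have hu2 := flow_C2 hu t0.
set f := u^~ t in hu2; pose a := sgrad f x; pose m := x - a.
pose E := expR (u x t); pose X := height x; pose Y := gheight x t.
have E0 : 0 < E by exact: expR_gt0.
have X0 : 0 < X by [].
have Y0 : 0 < Y by exact: gheight_gt0.
have YE : Y = E * X by [].
have ax : edot x a = 0 by exact: sgrad_radial.
have mm : edot m m = 1 + edot a a by rewrite !edotE xx [edot a x]edotC ax; ring.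
have mm0 : edot m m != 0 by rewrite mm gt_eqF // ltr_wpDr // edot_ge0.
have xm : edot x m = 1 by rewrite !edotE xx ax; ring.
pose PY := barrier_y sg B al ka b t Y (E * E).
pose PR := barrier_r B al ka b t Y (E * E).
pose PT := barrier_t sg B al ka b t Y (E * E).
pose G := expR (- 2 * al * t - ka * expR (- 2 * t) * (E * E - Y * Y)).
pose e2 := expR (- 2 * t); pose e3 := expR (3 * t).
pose La := PY * Y + 2 * PR * (E * E).
have lmax w : \forall s \near (0 : R),
    Psi (sproj (s *: w + x)) t <= Psi (sproj (0 *: w + x)) t.
  near=> s; rewrite scale0r add0r (sproj_id Sx); apply: smax; apply: sproj_hemisphere.
  by near: s; exact: near_halfspace_line.
have J w := jet2_barrier sg B al ka b t (lt0r_neq0 Y0)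
   (gheight_jet2 w Sx t0) (gsqnorm_jet2 w Sx t0).
(* La is the derivative of the barrier in the radial direction, on which u acts *)
have F1 : E * (PY + 2 * E * X * PR) = height m * La.
  have [+ _] := jet2_max (J (delta_mx 0 ord_max)) (lmax _).
  rewrite -/E -/X -/YE -/f -/a -/PY -/PR [edot _ a]edotC !edot_delta -/(height a) -/(height x) -/X.
  have -> : height (delta_mx 0 ord_max : 'rV[R]_n.+1) = 1 by rewrite /height mxE !eqxx.
  have -> : height m = X - height a by rewrite /height !mxE.
  rewrite /La YE => F; apply/eqP; rewrite -subr_eq0 -F; apply/eqP; ring.
(* w is orthogonal to m, hence the radial factor is stationary along the curve *)
have F2 j : let w := frame m j in
   La * (edot (w *m shess f x) w - edot w w + 2 * edot x w ^+ 2)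
   + 2 * PR * (E * E) * edot w w
   - (2 * B * G * ka * e2 * (E * E) + 2 * b * e3 * E ^+ 2 * Y^-1 ^+ 3)
      * edot (delta_mx 0 ord_max) w ^+ 2
   - 4 * B * G * ka ^+ 2 * e2 ^+ 2 * E ^+ 4 * edot (x - X *: delta_mx 0 ord_max) w ^+ 2 <= 0.
  move=> w; have [_] := jet2_max (J w) (lmax _).
  rewrite -/E -/X -/f -/a.
  have wm : edot w m = 0 by exact: frame_orth.
  clearbody w.
  have -> : edot w a = edot x w.
    by move: wm; rewrite /m !edotE => /eqP; rewrite subr_eq0 => /eqP <-; rewrite edotC.
  rewrite !edotE [edot (delta_mx _ _) w]edotC edot_delta -/(height w) -/PY -/PR -/G -/e2 -/e3.
  by move=> F; apply: le_trans F; rewrite le_eqVlt; apply/orP; left; apply/eqP; rewrite /La YE; ring.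
have Slap : La * (\sum_j (edot (frame m j *m shess f x) (frame m j)
        - edot (frame m j) (frame m j) + 2 * edot x (frame m j) ^+ 2))
   + 2 * PR * (E * E) * n%:R
   - (2 * B * G * ka * e2 * (E * E) + 2 * b * e3 * E ^+ 2 * Y^-1 ^+ 3)
   - 4 * B * G * ka ^+ 2 * e2 ^+ 2 * E ^+ 4 * (1 - X ^+ 2) <= 0.
  have G0 : 0 < G by exact: expR_gt0.
  have e20 : 0 < e2 by exact: expR_gt0.
  have e30 : 0 < e3 by exact: expR_gt0.
  have : \sum_j (La * (edot (frame m j *m shess f x) (frame m j)
        - edot (frame m j) (frame m j) + 2 * edot x (frame m j) ^+ 2)
     + 2 * PR * (E * E) * edot (frame m j) (frame m j)
     - (2 * B * G * ka * e2 * (E * E) + 2 * b * e3 * E ^+ 2 * Y^-1 ^+ 3)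
      * edot (delta_mx 0 ord_max) (frame m j) ^+ 2
     - 4 * B * G * ka ^+ 2 * e2 ^+ 2 * E ^+ 4
      * edot (x - X *: delta_mx 0 ord_max) (frame m j) ^+ 2) <= 0.
    by apply: sumr_le0 => j _; exact: F2.
  rewrite big_split /= sumrN -mulr_sumr big_split /= sumrN -mulr_sumr big_split /= -!mulr_sumr.
  rewrite sum_frame_dot // !sum_frame_sqr //.
  set C1 := 2 * B * G * ka * e2 * (E * E) + _; set C2 := 4 * B * G * ka ^+ 2 * e2 ^+ 2 * E ^+ 4.
  set S1 := edot _ _ - _; set S2 := edot (x - _) _ - _.
  have C10 : 0 <= C1 by rewrite addr_ge0 // !mulr_ge0 ?exprn_ge0 ?invr_ge0 // ltW.
  have C20 : 0 <= C2 by rewrite !mulr_ge0 ?exprn_ge0 // ltW.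
  have S11 : S1 <= 1.
    rewrite /S1 edot_delta [delta_mx _ _ _ _]mxE !eqxx /= lerBlDr lerDl.
    by rewrite mulr_ge0 ?sqr_ge0 // invr_ge0 edot_ge0.
  have S22 : S2 <= 1 - X ^+ 2.
    have z2 : edot (x - X *: delta_mx 0 ord_max) (x - X *: delta_mx 0 ord_max) = 1 - X ^+ 2.
      rewrite !edotE xx !edot_delta [edot _ x]edotC edot_delta -/(height x) -/X.
      by rewrite [delta_mx _ _ _ _]mxE !eqxx /=; ring.
    by rewrite /S2 lerBlDr z2 lerDl mulr_ge0 ?sqr_ge0 // invr_ge0 edot_ge0.
  by move=> F; apply: le_trans F; rewrite lerB ?lerB ?ler_wpM2l // ler_piMr.
have PDE := flow_equation hu n0 Sx t0.
rewrite /= -/f -/a -/m in PDE; move: PDE Slap.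
set SL := \sum_j _; set ut := derive1 (u x) t => PDE Slap.
have Tm : 0 <= PT + La * ut.
  have du := is_derive_exp (flow_is_derive hu Sx t0).
  have dY : is_derive t 1 (gheight x) (ut * Y).
    have := is_deriveM du (is_derive_cst (height x) t (1 : R)).
    by move/is_derive_eq; apply; rewrite /GRing.scale /= -/ut -/E -/X YE /cst -/X; ring.
  have dR : is_derive t 1 (gsqnorm x) (2 * ut * (E * E)).
    have := is_deriveM du du.
    by move/is_derive_eq; apply; rewrite /GRing.scale /= -/ut -/E; ring.
  have dP := is_derive_barrier sg B al ka b (lt0r_neq0 Y0) dY dR.
  have := is_derive_ge0_left_max t0 dP tmax.
  by rewrite -/Y -/E -/PT -/PY -/PR /La => /le_trans; apply; rewrite le_eqVlt; apply/orP; left; apply/eqP; ring.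
have nn : 0 < n%:R :> R by rewrite ltr0n.
have star : 0 <= n%:R * (PT + Y * PY)
   + X ^+ 2 * (2 * B * G * ka * e2 * (E * E) + 2 * b * e3 * E ^+ 2 * Y^-1 ^+ 3)
   + X ^+ 2 * (4 * B * G * ka ^+ 2 * e2 ^+ 2 * E ^+ 4 * (1 - X ^+ 2)).
  have H1 : 0 <= n%:R * (PT + La * ut) by rewrite mulr_ge0 // ltW.
  have H2 : 0 <= X ^+ 2 * - (La * SL + 2 * PR * (E * E) * n%:R
   - (2 * B * G * ka * e2 * (E * E) + 2 * b * e3 * E ^+ 2 * Y^-1 ^+ 3)
   - 4 * B * G * ka ^+ 2 * e2 ^+ 2 * E ^+ 4 * (1 - X ^+ 2)).
    by rewrite mulr_ge0 ?sqr_ge0 // oppr_ge0.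
  have H3 : n%:R * (La * ut) = X ^+ 2 * La * SL + n%:R * X * (E * (PY + 2 * E * X * PR)).
    by rewrite F1 mulrCA PDE -/X; ring.
  apply: le_trans (addr_ge0 H1 H2) _.
  by rewrite le_eqVlt; apply/orP; left; apply/eqP; rewrite mulrDr H3 YE; ring.
have G0 : 0 < G by exact: expR_gt0.
have e30 : 0 < e3 by exact: expR_gt0.
have qE : q ^+ 2 = e2 * Y ^+ 2.
  rewrite /q exprMn; congr (_ * _).
  by rewrite expr2 -expRD /e2; congr expR; ring.
pose D := e2 * (E ^+ 2 - Y ^+ 2).
have D0 : 0 <= D.
  rewrite mulr_ge0 ?expR_ge0 // YE exprMn -[X in X - _]mulr1 -mulrBr mulr_ge0 ?sqr_ge0 //.
  rewrite subr_ge0 -xx /edot (bigD1 ord_max) //= -expr2 lerDl.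
  by apply: sumr_ge0 => i _; rewrite -expr2 sqr_ge0.
have BG : B * G * (2 * (n%:R * al - ka * (n%:R - 1) * q ^+ 2)
     + 2 * ka * D * (2 * ka * q ^+ 2 - n%:R)) <= 0.
  have [->|Bn] := eqVneq B 0; first by rewrite !mul0r.
  have [|h1 h2] := hB; first by rewrite lt_neqAle eq_sym Bn.
  have h3 : 2 * (n%:R * al - ka * (n%:R - 1) * q ^+ 2) <= 0.
    by rewrite pmulr_rle0 // subr_le0.
  have h4 : 2 * ka * D * (2 * ka * q ^+ 2 - n%:R) <= 0.
    rewrite mulr_ge0_le0 ?subr_le0 //.
    exact: mulr_ge0 (mulr_ge0 (ler0n R 2) ka0) D0.
  by rewrite mulr_ge0_le0 ?mulr_ge0 ?(ltW G0) // -[X in _ <= X]addr0 lerD.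
have bad : 0 < b * e3 * (3 * n%:R * (E * E) + 2 * (n%:R - 1) * Y^-1).
  have n1 : 0 <= n%:R - 1 :> R by rewrite subr_ge0 ler1n.
  rewrite mulr_gt0 ?mulr_gt0 // ltr_pwDl ?mulr_gt0 // !mulr_ge0 //.
  by rewrite invr_ge0 ltW.
move: star; rewrite leNgt => /negP; apply.
apply: le_lt_trans (_ : - (b * e3 * (3 * n%:R * (E * E) + 2 * (n%:R - 1) * Y^-1)) < 0); last first.
  by rewrite oppr_lt0.
rewrite -subr_ge0; move: BG; rewrite -oppr_ge0 => /le_trans; apply.
rewrite le_eqVlt; apply/orP; left; apply/eqP.
rewrite /PT /PY /barrier_t /barrier_y -/G -/e2 -/e3 /D qE YE; field.
by rewrite !gt_eqF.
Unshelve. all: by end_near. Qed.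

End no_max.

(** * The maximum principle *)

Section compactness.
Variables (R : realType) (n : nat).

Lemma continuous_height : continuous (@height R n).
Proof. exact: coord_continuous. Qed.

Lemma continuous_edot_sqr : continuous (fun x : 'rV[R]_n => edot x x).
Proof.
move=> x; have C i : (fun y : 'rV[R]_n => y 0 i * y 0 i) @ x --> x 0 i * x 0 i.
  have ci : continuous (fun y : 'rV[R]_n => y 0 i) by exact: coord_continuous.
  exact: (@continuousM R _ _ _ x (ci x) (ci x)).
rewrite /continuous_at /edot; apply: cvg_big; first exact: add_continuous.
  exact: nbhs_filter.
by move=> i _; exact: C.
Qed.

Lemma edot_sqr_coord (x : 'rV[R]_n) i : x 0 i ^+ 2 <= edot x x.
Proof.
rewrite /edot (bigD1 i) //= -expr2 lerDl.
by apply: sumr_ge0 => j _; rewrite -expr2 sqr_ge0.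
Qed.

End compactness.

Lemma hemisphere_height_le1 (R : realType) n (x : 'rV[R]_n.+1) :
  hemisphere x -> height x <= 1.
Proof.
move=> Sx; have := edot_sqr_coord x ord_max; rewrite (hemisphere_edot Sx).
by rewrite expr_le1 // ltW //; case: Sx.
Qed.

Lemma compact_cap (R : realType) n (d : R) : 0 < d ->
  compact [set x : 'rV[R]_n.+1 | hemisphere x /\ d <= height x].
Proof.
move=> d0.
have -> : [set x : 'rV[R]_n.+1 | hemisphere x /\ d <= height x] =
   [set x | edot x x = 1] `&` [set x | d <= height x].
  apply/seteqP; split => x [/=].
    by move=> Sx dx; split => //; exact: hemisphere_edot.
  move=> xx dx; split => //; split; last exact: lt_le_trans dx.
  by rewrite /enorm xx sqrtr1.
apply: bounded_closed_compact.
  exists 1; split; first exact: num_real.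
  move=> M M1 x [/= xx _]; apply: (le_trans _ (ltW M1)).
  rewrite [leLHS]/Num.norm /= mx_normrE; apply: bigmax_le => // -[i j] _ /=.
  rewrite (ord1 i) -(@expr_le1 _ 2) // real_normK ?num_real //.
  by rewrite -xx edot_sqr_coord.
apply: closedI.
  apply: (closed_comp _ (@closed_eq R 1)) => x _; exact: continuous_edot_sqr.
apply: (closed_comp _ (@closed_ge R d)) => x _; exact: continuous_height.
Qed.

Section maximum_principle.
Variables (R : realType) (n : nat) (u : 'rV[R]_n.+1 -> R -> R).
Hypothesis hu : graphical_solution +oo%E u.
Hypothesis n0 : (0 < n)%N.
Variables (sg B al ka : R).
Hypotheses (sg1 : `|sg| <= 1) (B0 : 0 <= B) (ka0 : 0 <= ka).
Hypothesis hB : forall x t, hemisphere x -> 0 < t -> 0 < B ->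
  let q := expR (- t) * gheight u x t in
  n%:R * al <= ka * (n%:R - 1) * q ^+ 2 /\ 2 * ka * q ^+ 2 <= n%:R.
Implicit Types (x : 'rV[R]_n.+1) (b c t : R).

Let Psi b x t := barrier sg B al ka b t (gheight u x t) (gsqnorm u x t).

(** On a superlevel set, E - b E^2 - b / Y is bounded below, E being the norm of the
point and Y its height.  As E - b E^2 <= 1 / (4 b), this keeps Y away from 0; as
E (b E - 1) is bounded above, it bounds E.  Hence the height Y / E of x stays away
from 0, that is, x stays in a compact part of the hemisphere. *)
Lemma barrier_coercive b c : 0 < b -> exists2 d, 0 < d &
  forall x t, hemisphere x -> 0 <= t -> c <= Psi b x t -> d <= height x.
Proof.
move=> b0; pose c1 := (4 * b)^-1 + `|c| + 1; pose A := 1 + (1 + `|c|) / b.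
have c10 : 0 < c1 by rewrite ltr_wpDl // addr_ge0 // invr_ge0 mulr_ge0 // ltW.
have A0 : 0 < A by rewrite ltr_pwDl // divr_ge0 ?addr_ge0 // ltW.
exists (b / c1 / A); first by rewrite !divr_gt0.
move=> x t Sx t0 cP.
have X0 : 0 < height x by case: Sx.
have X1 := hemisphere_height_le1 Sx.
pose E := expR (u x t); have E0 : 0 < E by exact: expR_gt0.
pose Y := gheight u x t; have YE : Y = E * height x by [].
have Y0 : 0 < Y by exact: gheight_gt0.
have YleE : Y <= E by rewrite YE ler_piMr // ltW.
have key : c <= E - b * (E * E) - b * Y^-1.
  apply: le_trans cP _; rewrite /Psi /barrier -/Y.
  set G := expR (_ - _).
  have h1 : sg * (expR (- t) * Y) <= E.
    apply: le_trans (ler_norm _) _; rewrite normrM.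
    apply: (@le_trans _ _ (1 * Y)); last by rewrite mul1r.
    rewrite ler_pM // normrM ger0_norm ?expR_ge0 // ger0_norm ?(ltW Y0) //.
    by rewrite ler_piMl ?(ltW Y0) // -expR0 ler_expR oppr_le0.
  have h2 : 0 <= B * G by rewrite mulr_ge0 // expR_ge0.
  have h3 : b * (E * E + Y^-1) <= b * expR (3 * t) * (E * E + Y^-1).
    rewrite ler_wpM2r ?addr_ge0 ?mulr_ge0 ?invr_ge0 ?(ltW E0) ?(ltW Y0) //.
    by rewrite ler_peMr ?(ltW b0) // -expR0 ler_expR mulr_ge0.
  rewrite -/(gsqnorm u x t) (_ : gsqnorm u x t = E * E) //.
  lra.
have bY : b / c1 <= Y.
  rewrite ler_pdivrMr // mulrC -ler_pdivrMr //.
  have : E - b * (E * E) <= (4 * b)^-1.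
    rewrite -subr_ge0 (_ : _ - _ = b * (E - (2 * b)^-1) ^+ 2).
      by rewrite mulr_ge0 ?sqr_ge0 // ltW.
    by field; rewrite gt_eqF.
  have := ler_norm (- c); rewrite normrN /c1; lra.
have EA : E <= A.
  rewrite leNgt; apply/negP => AE.
  have E1 : 1 <= E by apply: le_trans (ltW AE); rewrite /A lerDl divr_ge0 ?addr_ge0 // ltW.
  have h1 : 1 + `|c| < b * E.
    rewrite mulrC -ltr_pdivrMr //; apply: le_lt_trans AE; rewrite /A lerDr //.
  have h2 : `|c| < E * (b * E - 1).
    apply: (@lt_le_trans _ _ (b * E - 1)); first by rewrite ltrBrDr addrC.
    by rewrite ler_peMl // subr_ge0 (le_trans _ (ltW h1)) // lerDl.
  have h3 : 0 <= b * Y^-1 by rewrite mulr_ge0 ?invr_ge0 ?ltW.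
  have := ler_norm (- c); rewrite normrN => h4.
  have : b * (E * E) - E = E * (b * E - 1) by ring.
  lra.
rewrite ler_pdivrMr //; apply: le_trans bY _; rewrite YE mulrC.
by rewrite ler_pM2l.
Qed.

Lemma barrier_continuous b d t1 : 0 < d ->
  {within [set x : 'rV[R]_n.+1 | hemisphere x /\ d <= height x] `*` `[0, t1],
    continuous (fun z => Psi b z.1 z.2)}.
Proof.
move=> d0; set K := _ `*` _.
have [_ _ uc _] := hu.
have uK : {within K, continuous (fun z : 'rV[R]_n.+1 * R => u z.1 z.2)}.
  apply: continuous_subspaceW uc => -[x t] [/= [Sx _]]; rewrite in_itv /= => /andP[t0 _].
  by split => //; exact: ltry.
apply/subspace_continuousP => -[x t] Kz; move/subspace_continuousP : uK => /(_ _ Kz) cu.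
have ct : (fun z : 'rV[R]_n.+1 * R => z.2) @ within K (nbhs (x, t)) --> t.
  by apply: cvg_within_filter; exact: cvg_snd.
have ch : (fun z : 'rV[R]_n.+1 * R => height z.1) @ within K (nbhs (x, t)) --> height x.
  apply: cvg_within_filter.
  by apply: (@cvg_comp _ _ _ fst (@height R n)); [exact: cvg_fst|exact: continuous_height].
have ce (c : R) : (fun z : 'rV[R]_n.+1 * R => expR (c * z.2)) @ within K (nbhs (x, t))
    --> expR (c * t).
  apply: (@cvg_comp _ _ _ (fun z : 'rV[R]_n.+1 * R => c * z.2) expR); last exact: continuous_expR.
  exact: cvgMl_tmp.
have cE : (fun z : 'rV[R]_n.+1 * R => expR (u z.1 z.2)) @ within K (nbhs (x, t))
    --> expR (u x t).
  apply: (@cvg_comp _ _ _ (fun z : 'rV[R]_n.+1 * R => u z.1 z.2) expR); last exact: continuous_expR.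
  exact: cu.
have cY : (fun z : 'rV[R]_n.+1 * R => gheight u z.1 z.2) @ within K (nbhs (x, t))
    --> gheight u x t by exact: cvgM.
have cR : (fun z : 'rV[R]_n.+1 * R => gsqnorm u z.1 z.2) @ within K (nbhs (x, t))
    --> gsqnorm u x t by exact: cvgM.
have cN : (fun z : 'rV[R]_n.+1 * R => expR (- z.2)) @ within K (nbhs (x, t)) --> expR (- t).
  apply: (@cvg_comp _ _ _ (fun z : 'rV[R]_n.+1 * R => - z.2) expR); last exact: continuous_expR.
  exact: cvgN.
have Y0 : gheight u x t != 0.
  by rewrite gt_eqF // gheight_gt0 //; case: Kz => -[].
rewrite /Psi /barrier; apply: cvgB; [apply: cvgB|].
- by apply: cvgMl_tmp; exact: cvgM.
- apply: cvgMl_tmp; apply: (@cvg_comp _ _ _ (fun z : 'rV[R]_n.+1 * R =>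
    -2 * al * z.2 - ka * expR (-2 * z.2) * (gsqnorm u z.1 z.2 - gheight u z.1 z.2 * gheight u z.1 z.2)) expR); last exact: continuous_expR.
  apply: cvgB; first exact: cvgMl_tmp.
  apply: cvgM; first exact: cvgMl_tmp.
  by apply: cvgB => //; exact: cvgM.
- apply: cvgM; first exact: cvgMl_tmp.
  by apply: cvgD => //; exact: cvgV.
Qed.

(** Otherwise the barrier, confined by [barrier_coercive], would have a maximum over a
bounded time interval, at a positive time, against [flow_no_interior_max]. *)
Lemma barrier_max_principle b M : 0 < b ->
  (forall x, hemisphere x -> Psi b x 0 <= M) ->
  forall x t, hemisphere x -> 0 <= t -> Psi b x t <= M.
Proof.
move=> b0 H0 x1 t1 Sx1 t10; rewrite leNgt; apply/negP => Mlt.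
have [d d0 Hd] := barrier_coercive (Psi b x1 t1) b0.
set K := [set x : 'rV[R]_n.+1 | hemisphere x /\ d <= height x] `*` `[0, t1]%classic.
have cK : compact K.
  by apply: compact_setX; [exact: compact_cap|exact: segment_compact].
have K1 : K (x1, t1).
  split => /=; last by rewrite in_itv /= t10 lexx.
  by split => //; exact: (Hd _ t1).
have [|[xm tm] /set_mem[/= [Sxm _]]] := @compact_EVT_max _ _ _ K _ cK (@barrier_continuous b d t1 d0).
  by exists (x1, t1).
rewrite in_itv /= => /andP[tm0 tm1] Hmax.
have gmax x t : hemisphere x -> 0 <= t -> t <= t1 -> Psi b x t <= Psi b xm tm.
  move=> Sx t0 tt1; have [h|h] := lerP (Psi b x1 t1) (Psi b x t).
    apply: (Hmax (x, t)); apply/mem_set; split => /=; last by rewrite in_itv /= t0.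
    by split => //; exact: (Hd _ t).
  apply: le_trans (ltW h) _; apply: (Hmax (x1, t1)); exact: mem_set.
have tmp : 0 < tm.
  rewrite lt_neqAle tm0 andbT; apply/eqP => tmE.
  have := gmax _ _ Sx1 t10 (lexx _); rewrite leNgt => /negP; apply.
  by apply: le_lt_trans Mlt; rewrite -tmE; exact: H0.
apply: (flow_no_interior_max hu (sg := sg) (B := B) (al := al) (ka := ka) (b := b) n0 Sxm tmp) => //.
- by move=> Bp; exact: hB.
- by move=> x' Sx'; exact: gmax.
- by move=> t' /andP[t'0 t'm]; apply: gmax => //; exact: le_trans t'm tm1.
Qed.

(** The penalization is removed by letting its coefficient tend to 0 at a fixed point;
the Gaussian is bounded above at time t by its amplitude, since r >= y^2. *)
Lemma flow_comparison M :
  (forall x, hemisphere x -> sg * gheight u x 0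
     - B * expR (- ka * (gsqnorm u x 0 - gheight u x 0 ^+ 2)) <= M) ->
  forall x t, hemisphere x -> 0 <= t ->
    sg * (expR (- t) * gheight u x t) - B * expR (- 2 * al * t) <= M.
Proof.
move=> H0 x t Sx t0.
pose Z := expR (3 * t) * (gsqnorm u x t + (gheight u x t)^-1).
have Y0 := gheight_gt0 u t Sx.
have Z0 : 0 < Z.
  by rewrite mulr_gt0 ?expR_gt0 // addr_gt0 ?invr_gt0 // mulr_gt0 ?expR_gt0.
apply/ler_addgt0Pr => e e0.
have bM : forall y, hemisphere y -> Psi (e / Z) y 0 <= M.
  move=> y Sy; apply: le_trans (H0 y Sy).
  rewrite /Psi /barrier !mulr0 !oppr0 expR0 mul1r mulr1 sub0r mulNr -expr2.
  rewrite gerBl mulr1 mulr_ge0 //; first by rewrite divr_ge0 // ltW.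
  by rewrite addr_ge0 ?mulr_ge0 ?invr_ge0 ?expR_ge0 // ltW // gheight_gt0.
have := barrier_max_principle (divr_gt0 e0 Z0) bM Sx t0.
rewrite /Psi /barrier -(mulrA (e / Z)) -/Z divfK ?gt_eqF // lerBlDr; apply: le_trans.
rewrite lerB // ler_wpM2l // ler_expR gerBl mulr_ge0 //.
  by rewrite mulr_ge0 // expR_ge0.
rewrite subr_ge0 /gheight /gsqnorm mulrACA ler_piMr ?mulr_ge0 ?expR_ge0 //.
by rewrite mulr_ile1 ?hemisphere_height_le1 // ltW //; case: Sx.
Qed.

End maximum_principle.

(** * Convergence to the soliton *)

Lemma expR_ratio_near (R : realType) (h e : R) : 0 < h -> 0 < e ->
  exists2 eta : R, 0 < eta & forall d, `|h * expR d - h| < eta -> `|d| < e.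
Proof.
move=> h0 e0; exists (h * Num.min (expR e - 1) (1 - expR (- e))).
  rewrite mulr_gt0 // lt_min !subr_gt0 -[X in X < _]expR0 ltr_expR e0 /=.
  by rewrite -expR0 ltr_expR oppr_lt0.
move=> d; rewrite -{2}[h]mulr1 -mulrBr normrM (gtr0_norm h0) ltr_pM2l // lt_min.
move=> /andP[d1 d2]; rewrite ltr_norml; apply/andP; split; rewrite -ltr_expR.
- by have := ler_norm (- (expR d - 1)); rewrite normrN; lra.
- by have := ler_norm (expR d - 1); lra.
Qed.

Lemma compact_pos_bounds (R : realType) (T : topologicalType) (K : set T) (g : T -> R) :
  compact K -> {within K, continuous g} -> (forall x, K x -> 0 < g x) ->
  exists2 c : R, 0 < c & exists2 C : R, 0 < C & forall x, K x -> c <= g x <= C.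
Proof.
move=> cK cg g0; have [K0|/set0P/negP/negPn/eqP K0] := pselect (K !=set0); last first.
  by exists 1 => //; exists 1 => // x; rewrite K0.
have [x1 /set_mem K1 H1] := compact_EVT_min K0 cK cg.
have [x2 /set_mem K2 H2] := compact_EVT_max K0 cK cg.
exists (g x1); first exact: g0.
exists (g x2); first exact: g0.
by move=> x Kx; rewrite H1 ?H2 //; exact: mem_set.
Qed.

Section initial.
Variables (R : realType) (n : nat) (u : 'rV[R]_n.+1 -> R -> R).
Hypothesis hu : graphical_solution +oo%E u.

Lemma initial_continuous (K : set 'rV[R]_n.+1) : K `<=` @hemisphere R n ->
  {within K, continuous (u^~ 0)}.
Proof.
move=> KS; have [_ _ /subspace_continuousP uc _] := hu.
apply/subspace_continuousP => x Kx.
have A0 : [set z : 'rV[R]_n.+1 * R | [/\ hemisphere z.1, 0 <= z.2 & (z.2%:E < +oo)%E]] (x, 0).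
  by split => /=; [exact: KS|exact: lexx|exact: ltry].
apply: (@cvg_comp _ _ _ (fun y => (y, 0 : R)) (fun z : 'rV[R]_n.+1 * R => u z.1 z.2)
  _ _ _ _ (uc _ A0)).
move=> P /= [[U V] /= [Ux V0] UV]; near=> y.
have Ky : K y by near: y; exact: withinT.
apply: UV; last by split => /=; [exact: KS|exact: lexx|exact: ltry].
split => /=; last exact: nbhs_singleton.
by near: y; apply: cvg_within.
Unshelve. all: by end_near. Qed.

Lemma initial_gheight_continuous (K : set 'rV[R]_n.+1) : K `<=` @hemisphere R n ->
  {within K, continuous (fun x => gheight u x 0)}.
Proof.
move=> KS; have /subspace_continuousP uc := initial_continuous KS.
apply/subspace_continuousP => x Kx; apply: cvgM.
  by apply: (@cvg_comp _ _ _ (u^~ 0) expR); [exact: uc|exact: continuous_expR].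
by apply: cvg_within_filter; exact: continuous_height.
Qed.

Lemma initial_gsqnorm_continuous (K : set 'rV[R]_n.+1) : K `<=` @hemisphere R n ->
  {within K, continuous (fun x => gsqnorm u x 0)}.
Proof.
move=> KS; have /subspace_continuousP uc := initial_continuous KS.
by apply/subspace_continuousP => x Kx; apply: cvgM;
  apply: (@cvg_comp _ _ _ (u^~ 0) expR); [exact: uc|exact: continuous_expR|exact: uc|exact: continuous_expR].
Qed.

(** The case B = 0 of the comparison: in the coordinate q, horizontal horospheres are
at rest under the flow. *)
Lemma horosphere_barrier (n0 : (0 < n)%N) (c C : R) :
  (forall x, hemisphere x -> c <= gheight u x 0 <= C) ->
  forall x t, hemisphere x -> 0 <= t -> c <= expR (- t) * gheight u x t <= C.
Proof.
move=> H0 x t Sx t0; apply/andP; split.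
- rewrite -lerN2 -mulN1r.
  have := @flow_comparison R n u hu n0 (-1) 0 0 0 _ _ _ _ (- c) _ x t Sx t0.
  rewrite (mul0r (expR (-2 * 0 * t))) subr0; apply; rewrite ?normrN ?normr1 //.
  + by move=> x' t' _ _; rewrite ltxx.
  + by move=> y Sy; rewrite mul0r subr0 mulN1r lerN2; case/andP: (H0 y Sy).
- rewrite -[X in X <= _]mul1r.
  have := @flow_comparison R n u hu n0 1 0 0 0 _ _ _ _ C _ x t Sx t0.
  rewrite (mul0r (expR (-2 * 0 * t))) subr0; apply; rewrite ?normr1 //.
  + by move=> x' t' _ _; rewrite ltxx.
  + by move=> y Sy; rewrite mul0r subr0 mul1r; case/andP: (H0 y Sy).
Qed.

End initial.

Lemma soliton_horosphere (R : realType) (n : nat) (v : 'rV[R]_n.+1 -> R -> R) :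
  graphical_translating_soliton v ->
  horizontal_horosphere (radial_graph (v^~ 0) @` @hemisphere R n) ->
  exists2 h : R, 0 < h & forall x (t : R), hemisphere x -> 0 <= t ->
    expR (v x t) * height x = h * expR t.
Proof.
move=> [_ vt _] [h h0 vh]; exists h => // x t Sx t0.
have : (radial_graph (v^~ t) @` @hemisphere R n) (radial_graph (v^~ t) x) by exists x.
rewrite vt // vh => -[p /= ph /(congr1 (@height R n))].
by rewrite /hyp_translation /radial_graph !heightZ ph mulrC.
Qed.

Section convergence.
Variables (R : realType) (n : nat) (u : 'rV[R]_n.+1 -> R -> R).
Hypotheses (hu : graphical_solution +oo%E u) (n2 : (2 <= n)%N).
Variable h : R.
Hypothesis h0 : 0 < h.
Hypothesis hlim : gheight u x 0 @[x --> @hemisphere_boundary R n] --> h.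

(** Near the boundary of the hemisphere by the limit, and elsewhere by compactness. *)
Lemma gheight_bounds : exists2 c : R, 0 < c & exists2 C : R, 0 < C &
  forall x, hemisphere x -> c <= gheight u x 0 <= C.
Proof.
have h20 : 0 < h / 2 by rewrite divr_gt0.
move/cvgrPdist_lt : hlim => /(_ _ h20) [K [cK KS HK]].
have [c c0 [C C0 cC]] := compact_pos_bounds cK (initial_gheight_continuous hu KS)
  (fun x Kx => gheight_gt0 u 0 (KS x Kx)).
exists (Num.min c (h / 2)); first by rewrite lt_min c0.
exists (Num.max C (2 * h)); first by rewrite lt_max C0.
move=> x Sx; rewrite ge_min le_max.
have [Kx|nKx] := pselect (K x); first by have /andP[-> ->] := cC x Kx.
have : `|h - gheight u x 0| < h / 2 by exact: HK.
rewrite ltr_norml => /andP[a1 a2]; apply/andP; split; apply/orP; right; lra.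
Qed.

(** The constants ka and al are the largest ones for which the bounds c <= q <= C make
the Gaussian a supersolution, and B is such that B times the initial Gaussian
exceeds C + h, which bounds |q - h|, on the compact set K outside which q is
already close to h. *)
Lemma gheight_converges (eta : R) : 0 < eta -> \forall t \near +oo,
  forall x, hemisphere x -> `|expR (- t) * gheight u x t - h| < eta.
Proof.
move=> eta0; have [c c0 [C C0 cC]] := gheight_bounds.
have n0 : (0 < n)%N by exact: leq_trans n2.
have nR : 0 < n%:R :> R by rewrite ltr0n.
have bnd := horosphere_barrier hu n0 cC.
pose ka := n%:R / (2 * C ^+ 2); pose al := ka * (n%:R - 1) * c ^+ 2 / n%:R.
have ka0 : 0 < ka by rewrite divr_gt0 // mulr_gt0 // exprn_gt0.
have n1 : 0 < n%:R - 1 :> R by rewrite subr_gt0 ltr1n.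
have al0 : 0 < al by exact: divr_gt0 (mulr_gt0 (mulr_gt0 ka0 n1) (exprn_gt0 _ c0)) nR.
have hB x t (B : R) : hemisphere x -> 0 < t -> 0 < B ->
  let q := expR (- t) * gheight u x t in
  n%:R * al <= ka * (n%:R - 1) * q ^+ 2 /\ 2 * ka * q ^+ 2 <= n%:R.
  move=> Sx t0 _ q; have /andP[q1 q2] := bnd x t Sx (ltW t0).
  have q0 : 0 <= q by apply: le_trans q1; exact: ltW.
  split.
    rewrite /al mulrC divfK ?gt_eqF //.
    apply: ler_wpM2l; first exact: mulr_ge0 (ltW ka0) (ltW n1).
    by rewrite ler_sqr ?nnegrE // ltW.
  rewrite (_ : n%:R = 2 * ka * C ^+ 2).
    apply: ler_wpM2l; first exact: mulr_ge0 (ler0n R 2) (ltW ka0).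
    by rewrite ler_sqr ?nnegrE // ltW.
  by rewrite /ka; field; rewrite gt_eqF.
have e20 : 0 < eta / 2 by rewrite divr_gt0.
move/cvgrPdist_lt : hlim => /(_ _ e20) [K [cK KS HK]].
pose G0 x := expR (- ka * (gsqnorm u x 0 - gheight u x 0 ^+ 2)).
have G00 x : 0 < G0 x by exact: expR_gt0.
have cG : {within K, continuous G0}.
  have /subspace_continuousP cr := initial_gsqnorm_continuous hu KS.
  have /subspace_continuousP cy := initial_gheight_continuous hu KS.
  apply/subspace_continuousP => x Kx.
  apply: (@cvg_comp _ _ _ (fun x => - ka * (gsqnorm u x 0 - gheight u x 0 ^+ 2)) expR);
    last exact: continuous_expR.
  apply: cvgMl_tmp; apply: cvgB; first exact: cr.
  under eq_fun do rewrite expr2.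
  by rewrite expr2; apply: cvgM; exact: cy.
have [g g0 [g1 _ gG]] := compact_pos_bounds cK cG (fun x _ => G00 x).
pose B := (C + h) / g.
have B0 : 0 < B by rewrite divr_gt0 // addr_gt0.
have cmp (sg : R) : `|sg| = 1 -> forall x t, hemisphere x -> 0 <= t ->
    sg * (expR (- t) * gheight u x t) - B * expR (- 2 * al * t) <= sg * h + eta / 2.
  move=> sg1; apply: (flow_comparison hu n0 (ka := ka)).
  - by rewrite sg1.
  - exact: ltW.
  - exact: ltW.
  - by move=> x t Sx t0 _; exact: (hB x t B).
  move=> x Sx; rewrite -/(G0 x) lerBlDr.
  have le1 z : sg * z <= `|z| by apply: le_trans (ler_norm _) _; rewrite normrM sg1 mul1r.
  have := le1 (gheight u x 0 - h); rewrite mulrBr => H.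
  have [Kx|nKx] := pselect (K x).
    have /andP[gx _] := gG x Kx.
    have : B * g <= B * G0 x by rewrite ler_wpM2l // ltW.
    rewrite /B divfK ?gt_eqF // -/B.
    have /andP[y1 y2] := cC x Sx.
    have : `|gheight u x 0 - h| <= C + h.
      have y3 := gheight_gt0 u 0 Sx.
      rewrite ler_norml; apply/andP; split.
        by clear -y3 h0 C0; lra.
      by apply: lerD => //; rewrite ge0_cp // ltW.
    lra.
  have : `|h - gheight u x 0| < eta / 2 by exact: HK.
  have : 0 < B * G0 x by rewrite mulr_gt0.
  rewrite distrC; lra.
near=> t => x Sx.
have t0 : 0 <= t by near: t; exact: nbhs_pinfty_ge.
(* from expR z >= 1 + z *)
have small : B * expR (- 2 * al * t) < eta / 2.
  have t1 : B / (eta * al) < t by near: t; apply: nbhs_pinfty_gt; exact: num_real.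
  rewrite (_ : -2 * al * t = - (2 * al * t)); last by ring.
  rewrite expRN ltr_pdivrMr ?expR_gt0 //.
  apply: (@lt_le_trans _ _ (eta / 2 * (1 + 2 * al * t))); last first.
    by rewrite ler_wpM2l ?(ltW e20) // expR_ge1Dx.
  move: t1; rewrite ltr_pdivrMr ?(mulr_gt0 eta0 al0) // => /lt_le_trans; apply.
  rewrite (_ : t * (eta * al) = eta / 2 * (2 * al * t)); last by field.
  by rewrite mulrDr mulr1 lerDr ltW.
have H1 := cmp 1 (normr1 _) x t Sx t0.
have H2 := cmp (-1) (normrN1 _) x t Sx t0.
by rewrite ltr_norml; apply/andP; split; lra.
Unshelve. all: by end_near. Qed.

End convergence.

Unset Implicit Arguments.
Set Strict Implicit.
Set Printing Implicit Defensive.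

Theorem theorem4p1 (R : realType) (n : nat) (hn : (2 <= n)%N)
    (v : 'rV[R]_n.+1 -> R -> R)
    (hv : graphical_translating_soliton v)
    (hv0 : horizontal_horosphere (radial_graph (v^~ 0) @` @hemisphere R n))
    (u0 : 'rV[R]_n.+1 -> R)
    (hu0 : locally_lipschitz_on (@hemisphere R n) u0)
    (hlim : `|u0 x - v x 0| @[x --> @hemisphere_boundary R n] --> (0 : R))
    (u : 'rV[R]_n.+1 -> R -> R)
    (hu : graphical_solution +oo%E u)
    (hinit : forall x, hemisphere x -> u x 0 = u0 x) :
  {uniform @hemisphere R n,
    (fun (t : R) (x : 'rV[R]_n.+1) => u x t - v x t) @ +oo --> (fun=> 0 : R)}.
Proof.
have [h h0 hvE] := soliton_horosphere hv hv0.
have qE x t : hemisphere x -> 0 <= t ->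
    expR (- t) * gheight u x t = h * expR (u x t - v x t).
  move=> Sx t0; have := hvE x t Sx t0; rewrite /gheight => E.
  have -> : h = expR (v x t) * height x / expR t by rewrite E mulfK // gt_eqF // expR_gt0.
  by rewrite expRD !expRN; field; rewrite !gt_eqF ?expR_gt0.
have lim0 : gheight u x 0 @[x --> @hemisphere_boundary R n] --> h.
  have d0 : (u0 x - v x 0) @[x --> @hemisphere_boundary R n] --> (0 : R).
    exact: norm_cvg0 hlim.
  have : h * expR (u0 x - v x 0) @[x --> @hemisphere_boundary R n] --> h * expR 0.
    apply: cvgMl_tmp; apply: (@cvg_comp _ _ _ (fun x => u0 x - v x 0) expR _ (nbhs (0 : R))) => //.
    exact: continuous_expR.
  rewrite expR0 mulr1; apply: cvg_trans; apply: near_eq_cvg.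
  (* the equality holds on the whole hemisphere: the compact set to remove is empty *)
  exists set0; split => //; first exact: compact0.
  by move=> x [Sx _] /=; rewrite -hinit // -qE // oppr0 expR0 mul1r.
move=> P /uniform_nbhs[U [entU UP]].
move: entU; rewrite -entourage_ballE => -[e /= e0 eU].
have [eta eta0 Heta] := expR_ratio_near h0 e0.
near=> t; apply: UP => x Sx; apply: eU; rewrite /ball /= sub0r normrN.
apply: Heta; rewrite -qE //.
  by move: x Sx; near: t; exact: (gheight_converges hu hn h0 lim0 eta0).
Unshelve. all: by end_near. Qed.
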